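(* The only distributive law of the operad $\mathcal{P}_1=\mathcal{C}om$ over the operad $\mathcal{P}_2=\mathcal{C}om$ (a second copy of the same operad) is the trivial one, $\mathcal{D}=0$.
   Context: Fix a field $\Bbbk$ of characteristic $0$; operads are symmetric operads in $\Bbbk$-vector spaces, and all generating operations have degree $0$. For a $\Sigma_2$-module $E$, $\mathcal{F}(E)$ is the free operad generated by $E$ placed in arity $2$; for a $\Sigma_3$-submodule $R\subseteq\mathcal{F}(E)(3)$, $\langle E;R\rangle=\mathcal{F}(E)/(R)$, where $(R)$ is the operad ideal generated by $R$. Let $\mathcal{P}_1=\langle E_1;R_1\rangle$, $\mathcal{P}_2=\langle E_2;R_2\rangle$ and $E=E_1\oplus E_2$. For $i,j\in\{1,2\}$ let $\mathcal{F}(E)(3)_{ij}\subseteq\mathcal{F}(E)(3)$ be the $\Sigma_3$-submodule generated by the compositions $\mu(1,\nu)$, $\mu(\nu,1)$ with $\mu\in E_i$ (root operation) and $\nu\in E_j$. Given a $\Sigma_3$-equivariant linear map $\mathcal{D}\colon\mathcal{F}(E)(3)_{12}\to\mathcal{F}(E)(3)_{21}$, let $R_{\mathcal{D}}$ be the submodule of all $x-\mathcal{D}(x)$, $x\in\mathcal{F}(E)(3)_{12}$, and let $\mathcal{P}=\langle E_1\oplus E_2;\,R_1\oplus R_{\mathcal{D}}\oplus R_2\rangle$. The canonical maps $\mathcal{P}_i\to\mathcal{P}$ and operadic composition in $\mathcal{P}$ induce, via $(\mu;\nu_1,\dots,\nu_l)\mapsto\mu(\nu_1,\dots,\nu_l)$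 with $\mu\in\mathcal{P}_2(l)$ and $\nu_s\in\mathcal{P}_1(m_s)$, $m_1+\cdots+m_l=n$, an equivariant map $\xi(n)\colon(\mathcal{P}_2\circ\mathcal{P}_1)(n)\to\mathcal{P}(n)$, where $\mathcal{P}_2\circ\mathcal{P}_1$ is the composite product of $\Sigma$-modules. The map $\mathcal{D}$ is called a distributive law of $\mathcal{P}_1$ over $\mathcal{P}_2$ if $\xi(n)$ is an isomorphism for every $n\ge2$. The map $\mathcal{D}=0$ is always a distributive law, called the trivial one. $\mathcal{C}om$ is the operad of commutative associative algebras: $E$ is the one-dimensional trivial $\Sigma_2$-module (one commutative binary operation) and $R$ is generated by the associativity relation. *)

(* Defs.v *)
From HB Require Import structures.
From mathcomp Require Import all_boot all_algebra perm.
From mathcomp Require Import finmap.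
From mathcomp Require Import boolp.
From mathcomp Require Import monalg.

Set Implicit Arguments.
Unset Strict Implicit.
Unset Printing Implicit Defensive.

Import GRing.Theory.
Local Open Scope ring_scope.

Section Span.
Variables (k : fieldType) (V : lmodType k) (S : V -> Prop).

Inductive lspan : V -> Prop :=
| lspan0 : lspan 0
| lspan_lin a x y : S x -> lspan y -> lspan (a *: x + y).

Lemma lspan_gen x : S x -> lspan x.
Proof.
by move=> Sx; rewrite -[x]addr0 -[x]scale1r; apply: lspan_lin lspan0.
Qed.

Lemma lspanD x y : lspan x -> lspan y -> lspan (x + y).
Proof.
move=> sx sy; elim: sx => [|a u v Su _ IH]; first by rewrite add0r.
by rewrite -addrA; apply: lspan_lin.
Qed.

Lemma lspanZ a x : lspan x -> lspan (a *: x).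
Proof.
elim=> [|b u v Su _ IH]; first by rewrite scaler0; apply: lspan0.
by rewrite scalerDr scalerA; apply: lspan_lin.
Qed.

Definition in_span : {pred V} := fun x => `[< lspan x >].

Lemma in_spanP x : reflect (lspan x) (x \in in_span).
Proof. exact: asboolP. Qed.

Fact in_span_submod : submod_closed in_span.
Proof.
split; first exact/in_spanP/lspan0.
by move=> a u v /in_spanP su /in_spanP sv; apply/in_spanP/lspanD/sv/lspanZ.
Qed.

HB.instance Definition _ := GRing.isSubmodClosed.Build k V in_span
  (GRing.submod_closed_semi in_span_submod).

(** The subspace of [V] spanned by [S]. *)
Record subspace := Subspace { subspace_val : V; _ : subspace_val \in in_span }.
HB.instance Definition _ := [isSub for subspace_val].
HB.instance Definition _ := [Choice of subspace by <:].
HB.instance Definition _ := [SubChoice_isSubLmodule of subspace by <:].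

(** The quotient of [V] by the subspace spanned by [S]. *)
Definition quot : Type := Quotient.quot in_span.
HB.instance Definition _ := GRing.Zmodule.on quot.

Definition qclass (x : V) : quot := (\pi_(Quotient.quot in_span) x)%qT.
Definition qrepr (x : quot) : V := repr (x : Quotient.quot in_span).

Lemma qreprK x : qclass (qrepr x) = x.
Proof. exact: reprK. Qed.

Lemma qclass_eq x y : qclass x = qclass y <-> lspan (x - y).
Proof.
split=> [/eqP|/in_spanP h]; last by apply/eqP; rewrite -Quotient.idealrBE.
by rewrite -Quotient.idealrBE => /in_spanP.
Qed.

Fact qclass_zmod_morphism : zmod_morphism qclass.
Proof. by move=> x y; rewrite /qclass !piE. Qed.

HB.instance Definition _ :=
  GRing.isZmodMorphism.Build V quot qclass qclass_zmod_morphism.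

Definition qscale (a : k) (x : quot) : quot := qclass (a *: qrepr x).

Lemma qscaleE a x : qscale a (qclass x) = qclass (a *: x).
Proof.
apply/qclass_eq; rewrite -scalerBr; apply: lspanZ.
by apply/qclass_eq; rewrite qreprK.
Qed.

Fact qscaleA a b x : qscale a (qscale b x) = qscale (a * b) x.
Proof. by rewrite -[x]qreprK !qscaleE scalerA. Qed.
Fact qscale1 : left_id 1 qscale.
Proof. by move=> x; rewrite -[x]qreprK !qscaleE scale1r. Qed.
Fact qscaleDr : right_distributive qscale +%R.
Proof.
move=> a x y; rewrite -[x]qreprK -[y]qreprK -raddfD !qscaleE -raddfD.
by rewrite scalerDr.
Qed.
Fact qscaleDl x : {morph qscale^~ x : a b / a + b}.
Proof. by move=> a b; rewrite -[x]qreprK !qscaleE -raddfD scalerDl. Qed.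

HB.instance Definition _ :=
  GRing.Zmodule_isLmodule.Build k quot qscaleA qscale1 qscaleDr qscaleDl.

Fact qclass_scalable : scalable qclass.
Proof. by move=> a x; apply/esym/qscaleE. Qed.

HB.instance Definition _ :=
  GRing.isScalable.Build k V quot *:%R qclass qclass_scalable.

(** A linear map vanishing on [S] descends to the quotient. *)
Lemma qdescE (W : lmodType k) (f : {linear V -> W}) x :
  (forall y, S y -> f y = 0) -> f (qrepr (qclass x)) = f x.
Proof.
move=> f0; apply/eqP; rewrite -subr_eq0 -linearB; apply/eqP.
have : lspan (qrepr (qclass x) - x) by apply/qclass_eq; rewrite qreprK.
elim=> [|a u v Su _ IH]; first exact: linear0.
by rewrite linearP f0 // scaler0 add0r.
Qed.

End Span.

(** Linear extension to the free vector space [{malg k[G]}] on [G]. *)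
Section LinearExtension.
Variables (k : fieldType) (G : choiceType) (W : lmodType k) (f : G -> W).

Definition linext (u : {malg k[G]}) : W := \sum_(g <- msupp u) u@_g *: f g.

Lemma linext_wide (d : {fset G}) u : (msupp u `<=` d)%fset ->
  linext u = \sum_(g <- d) u@_g *: f g.
Proof.
move=> sud; rewrite /linext (big_fset_incl _ sud) // => g _ /mcoeff_outdom ->.
by rewrite scale0r.
Qed.

Fact linext_linear : linear linext.
Proof.
move=> a u v; set d := (msupp u `|` msupp v)%fset.
have su : (msupp u `<=` d)%fset by apply: fsubsetUl.
have sv : (msupp v `<=` d)%fset by apply: fsubsetUr.
have suv : (msupp (a *: u + v) `<=` d)%fset.
  apply: (fsubset_trans (msuppD_le _ _)); rewrite fsubUset sv andbT.
  by apply: (fsubset_trans (msuppZ_le _ _)).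
rewrite (linext_wide su) (linext_wide sv) (linext_wide suv) scaler_sumr.
rewrite -big_split; apply: eq_bigr => g _ /=.
by rewrite mcoeffD mcoeffZ scalerDl scalerA.
Qed.

HB.instance Definition _ :=
  GRing.isLinear.Build k {malg k[G]} W *:%R linext linext_linear.

Lemma linextU g : linext << g >> = f g.
Proof.
by rewrite (linext_wide msuppU_le) big_seq_fset1 mcoeffUU scale1r.
Qed.

End LinearExtension.

(** A [Sigma_2]-module is a vector space with a linear involution, the action
    of the transposition. *)
Record sig2mod (k : fieldType) := Sig2Mod {
  sig2_car :> lmodType k;
  swap : sig2_car -> sig2_car;
  swap_linear : linear swap;
  swapK : involutive swap }.

Section DirectSum.
Variables (k : fieldType) (E1 E2 : sig2mod k).

Definition sum_swap (e : E1 * E2) : E1 * E2 := (swap e.1, swap e.2).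

Fact sum_swap_linear : linear sum_swap.
Proof. by move=> a x y; rewrite /sum_swap /= !swap_linear. Qed.

Fact sum_swapK : involutive sum_swap.
Proof. by case=> x y; rewrite /sum_swap /= !swapK. Qed.

Definition sig2_sum : sig2mod k := Sig2Mod sum_swap_linear sum_swapK.

Definition sig2_inl (e : E1) : sig2_sum := (e, 0).
Definition sig2_inr (e : E2) : sig2_sum := (0, e).

End DirectSum.

(** Planar binary trees, vertices decorated by [E], leaves labelled by [L]. *)
Inductive btree (E L : Type) :=
| Leaf of L
| Node of E & btree E L & btree E L.
Arguments Leaf {E L}.
Arguments Node {E L}.

HB.instance Definition _ (E L : Type) := gen_eqMixin (btree E L).
HB.instance Definition _ (E L : Type) := gen_choiceMixin (btree E L).

Fixpoint leaves E L (t : btree E L) : seq L :=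
  match t with
  | Leaf i => [:: i]
  | Node _ l r => leaves l ++ leaves r
  end.

(** Grafting of the tree [f i] on each leaf labelled [i]. *)
Fixpoint graft E L L' (f : L -> btree E L') (t : btree E L) : btree E L' :=
  match t with
  | Leaf i => f i
  | Node e l r => Node e (graft f l) (graft f r)
  end.

Definition tlabel E L L' (f : L -> L') : btree E L -> btree E L' :=
  graft (fun i => Leaf (f i)).

Fixpoint tdecor E E' L (h : E -> E') (t : btree E L) : btree E' L :=
  match t with
  | Leaf i => Leaf i
  | Node e l r => Node (h e) (tdecor h l) (tdecor h r)
  end.

Section FreeOperad.
Variables (k : fieldType) (E : sig2mod k).

(** [lin_rel a t t1 t2]: the three trees differ only in the decoration of one
    vertex, which is [a *: e1 + e2], [e1] and [e2] respectively. *)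
Inductive lin_rel L (a : k) : btree E L -> btree E L -> btree E L -> Prop :=
| lin_root e1 e2 l r :
    lin_rel a (Node (a *: e1 + e2) l r) (Node e1 l r) (Node e2 l r)
| lin_left e l l1 l2 r : lin_rel a l l1 l2 ->
    lin_rel a (Node e l r) (Node e l1 r) (Node e l2 r)
| lin_right e l r r1 r2 : lin_rel a r r1 r2 ->
    lin_rel a (Node e l r) (Node e l r1) (Node e l r2).

(** Equivariance at one vertex: [(e . (1 2))(x, y) = e(y, x)]. *)
Inductive swap_rel L : btree E L -> btree E L -> Prop :=
| swap_root e l r : swap_rel (Node (swap e) l r) (Node e r l)
| swap_left e l l' r : swap_rel l l' -> swap_rel (Node e l r) (Node e l' r)
| swap_right e l r r' : swap_rel r r' -> swap_rel (Node e l r) (Node e l r').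

(** Trees whose leaves are labelled bijectively by [0, ..., n-1]. *)
Definition is_ntree n (t : btree E 'I_n) := perm_eq (leaves t) (enum 'I_n).
Definition ntree n := {t : btree E 'I_n | is_ntree t}.

(** The basis vector of a tree, by convention [0] if the leaves of the tree are
    not labelled bijectively. *)
Definition tvec n (t : btree E 'I_n) : {malg k[ntree n]} :=
  if insub t is Some u then << (u : ntree n) >> else 0.

Inductive free_rel n : {malg k[ntree n]} -> Prop :=
| free_lin a t t1 t2 : lin_rel a t t1 t2 ->
    free_rel (tvec t - (a *: tvec t1 + tvec t2))
| free_swap t t' : swap_rel t t' -> free_rel (tvec t - tvec t').

(** The component F(E)(n) of the free operad, and its tree monomials. *)
Definition free_op n : lmodType k := quot (@free_rel n).
Definition mono n (t : btree E 'I_n) : free_op n := qclass _ (tvec t).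

(** The action of permutations by relabelling the leaves, defined for any map
    of labels (it is [0] unless the map is bijective). *)
Definition relabel_pre m n (f : 'I_m -> 'I_n) :
    {malg k[ntree m]} -> free_op n :=
  linext (fun t => mono (tlabel f (val t))).

Definition relabel m n (f : 'I_m -> 'I_n) (x : free_op m) : free_op n :=
  relabel_pre f (qrepr x).

(** The partial composition at the input [i], followed by a relabelling of the
    resulting inputs: the inputs [j != i] of the first operation become [f j],
    the inputs of the second one are relabelled by [g].  This is [0] unless
    these labels enumerate [0, ..., n-1] bijectively, whence [n = m + p - 1]. *)
Definition pcomp_tree m p n (i : 'I_m) (f : 'I_m -> 'I_n) (g : 'I_p -> 'I_n)
    (s : btree E 'I_m) (t : btree E 'I_p) : btree E 'I_n :=
  graft (fun j => if j == i then tlabel g t else Leaf (f j)) s.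

Definition pcomp_pre m p n (i : 'I_m) (f : 'I_m -> 'I_n) (g : 'I_p -> 'I_n)
    (u : {malg k[ntree m]}) (v : {malg k[ntree p]}) : free_op n :=
  linext (fun s => linext (fun t => mono (pcomp_tree i f g (val s) (val t))) v)
    u.

Definition pcomp m p n (i : 'I_m) (f : 'I_m -> 'I_n) (g : 'I_p -> 'I_n)
    (x : free_op m) (y : free_op p) : free_op n :=
  pcomp_pre i f g (qrepr x) (qrepr y).

Lemma leaves_graft L L' (f : L -> btree E L') t :
  leaves (graft f t) = flatten [seq leaves (f i) | i <- leaves t].
Proof.
elim: t => [i|e l IHl r IHr] /=; first by rewrite cats0.
by rewrite IHl IHr map_cat flatten_cat.
Qed.

Lemma lin_rel_leaves L a (t t1 t2 : btree E L) : lin_rel a t t1 t2 ->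
  leaves t1 = leaves t /\ leaves t2 = leaves t.
Proof. by elim=> //= {t t1 t2} e t t1 t2 r _ [-> ->]. Qed.

Lemma swap_rel_leaves (L : eqType) (t t' : btree E L) : swap_rel t t' ->
  perm_eq (leaves t) (leaves t').
Proof.
elim=> {t t'} /= [e l r|e l l' r _ h|e l r r' _ h].
- exact: permEl (perm_catC _ _).
- by rewrite perm_cat2r.
- by rewrite perm_cat2l.
Qed.

Lemma mono_eq0 n (t : btree E 'I_n) : ~~ is_ntree t -> mono t = 0.
Proof. by move=> nt; rewrite /mono /tvec insubN // raddf0. Qed.

Lemma mono_lin n a (t t1 t2 : btree E 'I_n) : lin_rel a t t1 t2 ->
  mono t = a *: mono t1 + mono t2.
Proof.
by move=> h; rewrite -linearP; apply/qclass_eq/lspan_gen/free_lin.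
Qed.

Lemma mono_swap n (t t' : btree E 'I_n) : swap_rel t t' -> mono t = mono t'.
Proof. by move=> h; apply/qclass_eq/lspan_gen/free_swap. Qed.

Lemma graft_lin L L' (f : L -> btree E L') a t t1 t2 :
  lin_rel a t t1 t2 -> lin_rel a (graft f t) (graft f t1) (graft f t2).
Proof. by elim=> *; constructor. Qed.

Lemma graft_swap L L' (f : L -> btree E L') t t' :
  swap_rel t t' -> swap_rel (graft f t) (graft f t').
Proof. by elim=> *; constructor. Qed.

(** A map on trees compatible with the relations descends to F(E)(m). *)
Lemma linext_tvec m (W : lmodType k) (h : btree E 'I_m -> W) t :
  is_ntree t -> linext (fun u : ntree m => h (val u)) (tvec t) = h t.
Proof. by move=> nt; rewrite /tvec insubT linextU. Qed.

Lemma free_descE m (W : lmodType k) (h : btree E 'I_m -> W) u :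
    (forall a t t1 t2, lin_rel a t t1 t2 -> h t = a *: h t1 + h t2) ->
    (forall t t', swap_rel t t' -> h t = h t') ->
  linext (fun t : ntree m => h (val t)) (qrepr (qclass (@free_rel m) u)) =
  linext (fun t : ntree m => h (val t)) u.
Proof.
move=> hlin hswap; apply: qdescE => _ [a t t1 t2 r|t t' r].
- have [e1 e2] := lin_rel_leaves r.
  have [nt|nt] := boolP (is_ntree t); last first.
    have nt1 : ~~ is_ntree t1 by rewrite /is_ntree e1.
    have nt2 : ~~ is_ntree t2 by rewrite /is_ntree e2.
    by rewrite /tvec !insubN // scaler0 addr0 subr0 linear0.
  have nt1 : is_ntree t1 by rewrite /is_ntree e1.
  have nt2 : is_ntree t2 by rewrite /is_ntree e2.
  by rewrite linearB linearP /= !(linext_tvec h) // (hlin _ _ _ _ r) subrr.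
- have e := swap_rel_leaves r.
  have [nt|nt] := boolP (is_ntree t); last first.
    have nt' : ~~ is_ntree t' by rewrite /is_ntree -(permPl e).
    by rewrite /tvec !insubN // subr0 linear0.
  have nt' : is_ntree t' by rewrite /is_ntree -(permPl e).
  by rewrite linearB /= !(linext_tvec h) // (hswap _ _ r) subrr.
Qed.

Lemma relabelE m n (f : 'I_m -> 'I_n) u :
  relabel f (qclass (@free_rel m) u) = relabel_pre f u.
Proof.
rewrite /relabel /relabel_pre.
apply: (free_descE (h := fun t => mono (tlabel f t))) => [a t t1 t2 r|t t' r].
  exact/mono_lin/graft_lin.
exact/mono_swap/graft_swap.
Qed.

Lemma relabel_mono m n (f : 'I_m -> 'I_n) t : is_ntree t ->
  relabel f (mono t) = mono (tlabel f t).
Proof.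
move=> nt; rewrite relabelE.
exact: (linext_tvec (fun t => mono (tlabel f t))).
Qed.

Fact relabel_linear m n (f : 'I_m -> 'I_n) : linear (relabel f).
Proof.
move=> a x y; rewrite -[x]qreprK -[y]qreprK -linearP !relabelE.
exact: linext_linear.
Qed.

HB.instance Definition _ m n (f : 'I_m -> 'I_n) :=
  GRing.isLinear.Build k (free_op m) (free_op n) *:%R (relabel f)
    (relabel_linear f).

Lemma graft_eq_in (L : eqType) L' (h h' : L -> btree E L') s :
  {in leaves s, h =1 h'} -> graft h s = graft h' s.
Proof.
elim: s => [j|e l IHl r IHr] /= hh'; first by apply: hh'; rewrite inE.
by rewrite IHl ?IHr // => j js; apply: hh'; rewrite mem_cat js ?orbT.
Qed.

Lemma graft_lin_at (L : eqType) L' a i (h h1 h2 : L -> btree E L') s :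
    (forall j, j != i -> h1 j = h j /\ h2 j = h j) ->
    lin_rel a (h i) (h1 i) (h2 i) -> count_mem i (leaves s) = 1%N ->
  lin_rel a (graft h s) (graft h1 s) (graft h2 s).
Proof.
move=> hne hi; elim: s => [j|e l IHl r IHr] /=.
  by rewrite addn0; case: eqP => // ->.
have same (t : btree E L) : count_mem i (leaves t) = 0%N ->
    graft h1 t = graft h t /\ graft h2 t = graft h t.
  move/eqP; rewrite -leqn0 leqNgt -has_count has_pred1 => ti.
  by split; apply: graft_eq_in => j jt;
    have /hne[] : j != i by apply: contraNneq ti => <-.
rewrite count_cat; case cl: (count_mem i (leaves l)) => [|c].
  by move=> cr; have [-> ->] := same _ cl; apply/lin_right/IHr.
case: c cl => [|c] cl //; rewrite add1n => -[cr].
by have [-> ->] := same _ cr; apply/lin_left/IHl.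
Qed.

Lemma graft_swap_at (L : eqType) L' i (h h' : L -> btree E L') s :
    (forall j, j != i -> h' j = h j) ->
    swap_rel (h i) (h' i) -> count_mem i (leaves s) = 1%N ->
  swap_rel (graft h s) (graft h' s).
Proof.
move=> hne hi; elim: s => [j|e l IHl r IHr] /=.
  by rewrite addn0; case: eqP => // ->.
have same (t : btree E L) : count_mem i (leaves t) = 0%N ->
    graft h' t = graft h t.
  move/eqP; rewrite -leqn0 leqNgt -has_count has_pred1 => ti.
  by apply: graft_eq_in => j jt; apply/hne; apply: contraNneq ti => <-.
rewrite count_cat; case cl: (count_mem i (leaves l)) => [|c].
  by move=> cr; rewrite (same _ cl); apply/swap_right/IHr.
case: c cl => [|c] cl //; rewrite add1n => -[cr].
by rewrite (same _ cr); apply/swap_left/IHl.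
Qed.

Lemma ntree_count n (s : ntree n) i : count_mem i (leaves (val s)) = 1%N.
Proof.
by rewrite (seq.permP (valP s)) count_uniq_mem ?enum_uniq // mem_enum.
Qed.

Lemma linextC (G G' : choiceType) (W : lmodType k) (h : G -> G' -> W) u v :
  linext (fun s => linext (h s) v) u = linext (fun t => linext (h^~ t) u) v.
Proof.
rewrite /linext; under eq_bigr do rewrite scaler_sumr.
rewrite exchange_big /=; apply: eq_bigr => t _; rewrite scaler_sumr.
by apply: eq_bigr => s _; rewrite !scalerA mulrC.
Qed.

Lemma linextDr (G : choiceType) (W : lmodType k) (h1 h2 : G -> W) a u :
  linext (fun g => a *: h1 g + h2 g) u = a *: linext h1 u + linext h2 u.
Proof.
rewrite /linext scaler_sumr -big_split; apply: eq_bigr => g _ /=.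
by rewrite scalerDr !scalerA mulrC.
Qed.

Lemma pcompE m p n i (f : 'I_m -> 'I_n) (g : 'I_p -> 'I_n) u v :
  pcomp i f g (qclass (@free_rel m) u) (qclass (@free_rel p) v) =
  pcomp_pre i f g u v.
Proof.
rewrite /pcomp /pcomp_pre; set v' := qrepr (qclass _ v).
rewrite (free_descE (h := fun s => linext (fun t : ntree p =>
  mono (pcomp_tree i f g s (val t))) v')); first last.
- move=> s s' r; apply: eq_bigr => t _; congr (_ *: _).
  exact/mono_swap/graft_swap.
- move=> a s s1 s2 r; rewrite -linextDr; apply: eq_bigr => t _.
  by congr (_ *: _); apply/mono_lin/graft_lin.
rewrite [LHS]linextC [RHS]linextC.
apply: (free_descE (h := fun t => linext (fun s : ntree m =>
  mono (pcomp_tree i f g (val s) t)) u)) => [a t t1 t2 r|t t' r].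
- rewrite -linextDr; apply: eq_bigr => s _; congr (_ *: _).
  apply/mono_lin/(@graft_lin_at _ _ _ i) => [j /negbTE->//||].
    by rewrite eqxx; apply: graft_lin.
  exact: ntree_count.
- apply: eq_bigr => s _; congr (_ *: _).
  apply/mono_swap/(@graft_swap_at _ _ i) => [j /negbTE->//||].
    by rewrite eqxx; apply: graft_swap.
  exact: ntree_count.
Qed.

Lemma relabel_pcomp m n (f : 'I_m.+1 -> 'I_n) x :
  relabel f x = pcomp ord0 f (fun=> f ord0) x (mono (Leaf (ord0 : 'I_1))).
Proof.
rewrite -[x]qreprK relabelE pcompE; apply: eq_bigr => s _; congr (_ *: _).
have nt : is_ntree (Leaf (ord0 : 'I_1) : btree E 'I_1).
  by rewrite /is_ntree enum_ordSl enum_ord0.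
rewrite (linext_tvec (fun t => mono (pcomp_tree ord0 f _ (val s) t)) nt).
congr mono; apply: graft_eq_in => j _ /=.
by case: eqP => [->|].
Qed.

Lemma free0_eq0 (x : free_op 0) : x = 0.
Proof.
rewrite -[x]qreprK (_ : qrepr x = 0) ?raddf0 //; apply/malgP=> -[t nt].
suff [i] : exists i : 'I_0, true by case: i.
by elim: t {nt} => [i|//]; exists i.
Qed.

(** The [Sigma_3]-submodule generated by [X] is spanned by the orbits of [X]. *)
Definition orbits3 (X : free_op 3 -> Prop) (y : free_op 3) : Prop :=
  exists (s : 'S_3) (x : free_op 3), X x /\ y = relabel s x.

Section Quotient.
Variable R : free_op 3 -> Prop.

(** The operadic ideal (R).  Relabellings are instances of [pcomp] with a unit
    (see [relabel_pcomp]), so closure under the symmetric groups is included. *)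
Inductive ideal : forall n, free_op n -> Prop :=
| ideal_gen x : R x -> ideal x
| ideal_zero n : ideal (0 : free_op n)
| ideal_lin n a (x y : free_op n) : ideal x -> ideal y -> ideal (a *: x + y)
| ideal_compl m p n (i : 'I_m) (f : 'I_m -> 'I_n) (g : 'I_p -> 'I_n) x y :
    ideal x -> ideal (pcomp i f g x y)
| ideal_compr m p n (i : 'I_m) (f : 'I_m -> 'I_n) (g : 'I_p -> 'I_n) x y :
    ideal y -> ideal (pcomp i f g x y).

(** The component <E; R>(n). *)
Definition operad n : lmodType k := quot (@ideal n).
Definition omono n (t : btree E 'I_n) : operad n := qclass _ (mono t).

Definition oact n (s : 'S_n) (x : operad n) : operad n :=
  qclass _ (relabel s (qrepr x)).

Lemma ideal_relabel n (s : 'S_n) x : ideal x -> ideal (relabel s x).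
Proof.
case: n s x => [|n] s x ix; last by rewrite relabel_pcomp; apply: ideal_compl.
by rewrite [relabel s x]free0_eq0; apply: ideal_zero.
Qed.

Lemma oactE n (s : 'S_n) x :
  oact s (qclass (@ideal n) x) = qclass (@ideal n) (relabel s x).
Proof.
apply: (@qdescE _ _ (@ideal n) _ (@qclass _ _ (@ideal n) \o relabel s)).
move=> y iy /=; rewrite -[RHS](raddf0 (qclass (@ideal n))).
by apply/qclass_eq/lspan_gen; rewrite subr0; apply: ideal_relabel.
Qed.

End Quotient.

End FreeOperad.

(** The component (M o N)(n) of the composite product of two [Sigma]-modules
    [M] and [N], with actions [actM] and [actN].  The direct sum over l and
    m_1 + ... + m_l = n of the spaces
    M(l) (x) Ind (N(m_1) (x) ... (x) N(m_l)), with coinvariants taken under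
    [Sigma_l], is presented by the following generators and relations. *)
Section CompositeProduct.
Variables (k : fieldType) (M N : nat -> lmodType k).
Variables (actM : forall n, 'S_n -> M n -> M n).
Variables (actN : forall n, 'S_n -> N n -> N n).

(** The generator (mu; nu_1, ..., nu_l), together with a bijective labelling
    of the m_1 + ... + m_l inputs by [0, ..., n-1]. *)
Record comp_gen n := CompGen {
  comp_arity : nat;
  comp_top : M comp_arity;
  comp_arities : 'I_comp_arity -> nat;
  comp_inner : forall s, N (comp_arities s);
  comp_label : forall s, 'I_(comp_arities s) -> 'I_n;
  comp_label_bij :
    bijective (fun p : {s : 'I_comp_arity & 'I_(comp_arities s)} =>
                 comp_label (tagged p)) }.

Definition comp_free n := {malg k[{classic comp_gen n}]}.

Definition comp_vec n l (mu : M l) (m : 'I_l -> nat) (nu : forall s, N (m s))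
    (f : forall s, 'I_(m s) -> 'I_n)
    (fbij : bijective (fun p : {s : 'I_l & 'I_(m s)} => f _ (tagged p))) :
    comp_free n :=
  << (CompGen mu nu fbij : {classic comp_gen n}) >>.

Inductive comp_rel n : comp_free n -> Prop :=
| comp_rel_top l a (mu1 mu2 : M l) m (nu : forall s, N (m s)) f fbij :
    comp_rel (@comp_vec n l (a *: mu1 + mu2) m nu f fbij -
      (a *: @comp_vec n l mu1 m nu f fbij + @comp_vec n l mu2 m nu f fbij))
| comp_rel_inner l (mu : M l) m s a (nu nu1 nu2 : forall s, N (m s)) f fbij :
    nu s = a *: nu1 s + nu2 s ->
    (forall r, r != s -> nu1 r = nu r /\ nu2 r = nu r) ->
    comp_rel (@comp_vec n l mu m nu f fbij -
      (a *: @comp_vec n l mu m nu1 f fbij + @comp_vec n l mu m nu2 f fbij))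
| comp_rel_sym_top l (t : 'S_l) (mu : M l) m (nu : forall s, N (m s))
    f fbij fbij' :
    comp_rel (@comp_vec n l (actM t mu) m nu f fbij -
      @comp_vec n l mu (fun s => m (t s)) (fun s => nu (t s))
        (fun s => f (t s)) fbij')
| comp_rel_sym_inner l (mu : M l) m (t : forall s, 'S_(m s))
    (nu : forall s, N (m s)) f fbij fbij' :
    comp_rel (@comp_vec n l mu m (fun s => actN (t s) (nu s)) f fbij -
      @comp_vec n l mu m nu (fun s i => f s (t s i)) fbij').

Definition comp_prod n : lmodType k := quot (@comp_rel n).

Definition comp_class n l (mu : M l) (m : 'I_l -> nat) (nu : forall s, N (m s))
    (f : forall s, 'I_(m s) -> 'I_n)
    (fbij : bijective (fun p : {s : 'I_l & 'I_(m s)} => f _ (tagged p))) :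
    comp_prod n :=
  qclass _ (comp_vec mu nu fbij).

End CompositeProduct.

Section DistributiveLaw.
Variables (k : fieldType) (E1 E2 : sig2mod k).
Variables (R1 : free_op E1 3 -> Prop) (R2 : free_op E2 3 -> Prop).

Local Notation E := (sig2_sum E1 E2).
Local Notation inc1 := (@sig2_inl k E1 E2).
Local Notation inc2 := (@sig2_inr k E1 E2).

(** The map F(E') -> F(E) induced by a morphism [h] of generators. *)
Definition free_map (E' : sig2mod k) (h : E' -> E) n (x : free_op E' n) :
    free_op E n :=
  linext (fun t => mono (tdecor h (val t))) (qrepr x).

Lemma free_mapE (E' : sig2mod k) (h : E' -> E) n u :
    linear h -> {morph h : e / swap e} ->
  free_map h (qclass (@free_rel k E' n) u) =
  linext (fun t => mono (tdecor h (val t))) u.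
Proof.
move=> hlin hswap; apply: (free_descE (h := fun t => mono (tdecor h t))).
  move=> a t t1 t2 r; apply: mono_lin.
  by elim: r => *; rewrite /= ?hlin; constructor.
move=> t t' r; apply: mono_swap.
by elim: r => *; rewrite /= ?hswap; constructor.
Qed.

Fact sig2_inl_linear : linear inc1.
Proof. by move=> a x y; rewrite /sig2_inl -[RHS]/(_, _) /= scaler0 addr0. Qed.
Fact sig2_inl_swap : {morph inc1 : e / swap e}.
Proof.
move=> e; rewrite /= /sum_swap /sig2_inl /=; congr (_, _).
by have := swap_linear (-1) (0 : E2) 0; rewrite scaleN1r addNr scaleN1r addNr.
Qed.
Fact sig2_inr_linear : linear inc2.
Proof. by move=> a x y; rewrite /sig2_inr -[RHS]/(_, _) /= scaler0 addr0. Qed.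
Fact sig2_inr_swap : {morph inc2 : e / swap e}.
Proof.
move=> e; rewrite /= /sum_swap /sig2_inr /=; congr (_, _).
by have := swap_linear (-1) (0 : E1) 0; rewrite scaleN1r addNr scaleN1r addNr.
Qed.

Definition leaf0 : 'I_3 := @Ordinal 3 0 isT.
Definition leaf1 : 'I_3 := @Ordinal 3 1 isT.
Definition leaf2 : 'I_3 := @Ordinal 3 2 isT.

(** The compositions mu(1, nu) and mu(nu, 1). *)
Inductive two_level (A B : sig2mod k) (h : A -> E) (g : B -> E) :
    free_op E 3 -> Prop :=
| two_level_r (mu : A) (nu : B) : two_level h g
    (mono (Node (h mu) (Leaf leaf0) (Node (g nu) (Leaf leaf1) (Leaf leaf2))))
| two_level_l (mu : A) (nu : B) : two_level h g
    (mono (Node (h mu) (Node (g nu) (Leaf leaf0) (Leaf leaf1)) (Leaf leaf2))).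

(** F(E)(3)_12 and F(E)(3)_21. *)
Definition free3_12 : lmodType k := subspace (orbits3 (two_level inc1 inc2)).
Definition free3_21 : lmodType k := subspace (orbits3 (two_level inc2 inc1)).

Definition equivariant3 (D : free3_12 -> free3_21) : Prop :=
  forall (s : 'S_3) (x y : free3_12),
    val y = relabel s (val x) -> val (D y) = relabel s (val (D x)).

Variable D : {linear free3_12 -> free3_21}.

(** R_1 + R_D + R_2, for submodules R_1 and R_2. *)
Definition dist_rel (y : free_op E 3) : Prop :=
  exists r1 x r2, [/\ R1 r1, R2 r2 &
    y = free_map inc1 r1 + (val x - val (D x)) + free_map inc2 r2].

Definition comp21 n : lmodType k :=
  comp_prod (@oact _ _ R2) (@oact _ _ R1) n.

(** The map (mu; nu_1, ..., nu_l) |-> mu(nu_1, ..., nu_l).  It suffices to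
    prescribe it on tree monomials: their classes span <E_i; R_i>, and the
    generators of the composite product are multilinear. *)
Definition is_xi n (xi : comp21 n -> operad dist_rel n) : Prop :=
  forall l (t : btree E2 'I_l) (m : 'I_l -> nat)
    (u : forall s, btree E1 'I_(m s)) (f : forall s, 'I_(m s) -> 'I_n) fbij,
  is_ntree t -> (forall s, is_ntree (u s)) ->
  xi (@comp_class _ _ _ _ _ n l (omono R2 t) m (fun s => omono R1 (u s)) f fbij)
  = omono dist_rel
      (graft (fun s => tlabel (f s) (tdecor inc1 (u s))) (tdecor inc2 t)).

Definition distributive_law : Prop :=
  forall n, (2 <= n)%N -> exists xi : {linear comp21 n -> operad dist_rel n},
    is_xi xi /\ bijective xi.

End DistributiveLaw.

Section Com.
Variable k : fieldType.

(** The trivial one-dimensional [Sigma_2]-module. *)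
Fact com_swap_linear : linear (@id k^o).
Proof. by []. Qed.
Fact com_swapK : involutive (@id k^o).
Proof. by []. Qed.
Definition comE : sig2mod k := Sig2Mod com_swap_linear com_swapK.

Definition assoc_rel (y : free_op comE 3) : Prop :=
  let mul l r := Node (1 : comE) l r in
  y = mono (mul (mul (Leaf leaf0) (Leaf leaf1)) (Leaf leaf2))
      - mono (mul (Leaf leaf0) (mul (Leaf leaf1) (Leaf leaf2))).

(** The [Sigma_3]-submodule generated by associativity. *)
Definition comR : free_op comE 3 -> Prop := lspan (orbits3 assoc_rel).

End Com.

(* Main.v *)
(** Write [•] for the operation of P_1 and [∘] for that of P_2.  For any D, the
    classes of the products [∘_A •_(i in A) x_i] over the set partitions of
    {0, ..., n-1} are the images of the elements of a basis of (P_2 o P_1)(n).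

    Write [D (x • (y ∘ z)) = c0 x ∘ (y • z) + c1 y ∘ (x • z) + c2 z ∘ (x • y)].  If
    xi(4) is injective, both expansions of the associativity relation
    [((x ∘ y) • z) • w = (x ∘ y) • (z • w)] must have the same coefficients on
    partitions into two pairs; this gives [c1^2 = 0], [c2^2 = 0] and
    [c0 c2 = c0], hence [D = 0].

    Conversely, for D = 0 a [•] one of whose arguments is a [∘] vanishes, so the partitions
    span P(n).  They are separated by evaluating in the algebras W + k, W a
    polynomial ring, where [•] is the product of W and [∘] multiplies the values of
    a linear functional that detects the blocks of one partition. *)
From HB Require Import structures.
From mathcomp Require Import all_boot all_algebra perm.
From mathcomp Require Import finmap boolp mpoly monalg.
From mathcomp Require Import zify ring.
Require Import Defs.

Set Implicit Arguments.
Unset Strict Implicit.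
Unset Printing Implicit Defensive.

Import GRing.Theory.
Local Open Scope ring_scope.

(** The operad P is known only by generators and relations. Its identities must be applied at
    subtrees, but a proper subtree is not bijectively labelled, so its own class is 0 by convention;
    identities are therefore stated in an arbitrary context around the subtree. Linear independence,
    on the other hand, needs a model. When D = 0, [•] must kill every [∘]-product; this is obtained
    by letting [∘] take its values in a summand k that [•] ignores, and then [∘] can retain only one
    scalar per argument. Hence a functional on W, and a separate algebra for each partition. It only
    detects whether the blocks of one partition are all blocks of another, but this forces equality
    because both cover {0, ..., n-1}. Arity 4 is the first in which associativity of [•] meets a
    [∘]-product, and the partitions into two pairs isolate the squares of c1 and c2, each as a
    single term. *)

Inductive ctx (E L : Type) :=
| Hole
| CtxL of E & ctx E L & btree E L
| CtxR of E & btree E L & ctx E L.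
Arguments Hole {E L}.

(** The hole is innermost: [CtxL e K r] puts the vertex [e] right above it. *)
Fixpoint plug E L (K : ctx E L) (t : btree E L) : btree E L :=
  match K with
  | Hole => t
  | CtxL e K r => plug K (Node e t r)
  | CtxR e l K => plug K (Node e l t)
  end.

Fixpoint nodes E L (t : btree E L) : nat :=
  if t is Node _ l r then (nodes l + nodes r).+1 else 0.

Definition lin_of (k : fieldType) (V W : lmodType k) (f : V -> W)
    (f_lin : linear f) : {linear V -> W} :=
  HB.pack f (GRing.isLinear.Build k V W *:%R f f_lin).

(** * Substitution into tree monomials and the operadic ideal *)

Section Substitution.
Variables (k : fieldType) (E : sig2mod k).

Lemma linear_linext (G : choiceType) (V W : lmodType k) (F : {linear V -> W})
    (f : G -> V) u : F (linext f u) = linext (F \o f) u.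
Proof. by rewrite /linext linear_sum; apply: eq_bigr => g _; rewrite linearZ. Qed.

Lemma free_linext n (x : free_op E n) :
  x = linext (fun t : ntree E n => mono (val t)) (qrepr x).
Proof.
rewrite -{1}[x]qreprK {1}[qrepr x]monalgE linear_sum /=.
apply: eq_bigr => t _.
have -> : << (mcoeff t (qrepr x)) *g t >> = mcoeff t (qrepr x) *: << t >> :> {malg k[ntree E n]}.
  by apply/malgP => t'; rewrite mcoeffZ !mcoeffU mulr_natr.
rewrite linearZ /=; congr (_ *: _).
by rewrite /mono /tvec (insubT _ (valP t)); congr (qclass _ << _ >>); apply: val_inj.
Qed.

Lemma free_lin_eq n (W : lmodType k) (F G : {linear free_op E n -> W}) :
  (forall t, is_ntree t -> F (mono t) = G (mono t)) -> F =1 G.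
Proof.
move=> FG x; rewrite [x]free_linext !linear_linext.
by apply: eq_bigr => t _ /=; rewrite FG //; apply: valP.
Qed.

Section Gsub.
Variables (m n : nat) (h : 'I_m -> btree E 'I_n).

(** No condition on [h] is imposed, since [mono] is 0 on trees that are not bijectively labelled.
    The relations of the free operad live at the vertices of the tree, so grafting on its leaves
    respects them. *)
Definition gsub (x : free_op E m) : free_op E n :=
  linext (fun t : ntree E m => mono (graft h (val t))) (qrepr x).

Lemma gsubE u : gsub (qclass (@free_rel k E m) u) =
  linext (fun t : ntree E m => mono (graft h (val t))) u.
Proof.
apply: (free_descE (h := fun t => mono (graft h t))) => [a t t1 t2 r|t t' r].
  exact/mono_lin/graft_lin.
exact/mono_swap/graft_swap.
Qed.

Fact gsub_linear : linear gsub.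
Proof.
move=> a x y; rewrite -[x]qreprK -[y]qreprK -linearP !gsubE.
exact: linext_linear.
Qed.

HB.instance Definition _ :=
  GRing.isLinear.Build k (free_op E m) (free_op E n) *:%R gsub gsub_linear.

Lemma gsub_mono t : is_ntree t -> gsub (mono t) = mono (graft h t).
Proof.
by move=> nt; rewrite gsubE; apply: (linext_tvec (fun t => mono (graft h t))).
Qed.
End Gsub.

Lemma pcomp_mono m p n (i : 'I_m) (f : 'I_m -> 'I_n) (g : 'I_p -> 'I_n)
    (s : btree E 'I_m) (t : btree E 'I_p) : is_ntree s -> is_ntree t ->
  pcomp i f g (mono s) (mono t) = mono (pcomp_tree i f g s t).
Proof.
move=> ns nt; rewrite pcompE /pcomp_pre.
rewrite (linext_tvec (fun s => linext (fun t : ntree E p =>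
  mono (pcomp_tree i f g s (val t))) (tvec t))) //.
exact: (linext_tvec (fun t => mono (pcomp_tree i f g s t))).
Qed.

Section PcompLinear.
Variables (m p n : nat) (i : 'I_m) (f : 'I_m -> 'I_n) (g : 'I_p -> 'I_n).

Fact pcomp_linear_l y : linear (fun x => @pcomp k E m p n i f g x y).
Proof.
move=> a x x'; rewrite -[x]qreprK -[x']qreprK -[y]qreprK -linearP !pcompE.
exact: linext_linear.
Qed.

Fact pcomp_linear_r x : linear (fun y => @pcomp k E m p n i f g x y).
Proof.
move=> a y y'; rewrite -[x]qreprK -[y]qreprK -[y']qreprK -linearP !pcompE.
rewrite /pcomp_pre -linextDr; apply: eq_bigr => s _; congr (_ *: _).
exact: linext_linear.
Qed.

Definition pcompl y x := @pcomp k E m p n i f g x y.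
HB.instance Definition _ y :=
  GRing.isLinear.Build k _ _ *:%R (pcompl y) (pcomp_linear_l y).
Definition pcompr x y := @pcomp k E m p n i f g x y.
HB.instance Definition _ x :=
  GRing.isLinear.Build k _ _ *:%R (pcompr x) (pcomp_linear_r x).
End PcompLinear.

Lemma leaves_tlabel (E' : Type) L L' (f : L -> L') (t : btree E' L) :
  leaves (tlabel f t) = map f (leaves t).
Proof. by elim: t => //= e l -> r ->; rewrite map_cat. Qed.

Lemma graft_graft (E' : Type) L L' L'' (f : L -> btree E' L') (g : L' -> btree E' L'') t :
  graft g (graft f t) = graft (fun i => graft g (f i)) t.
Proof. by elim: t => //= e l -> r ->. Qed.

Lemma graft_ext (E' : Type) L L' (f g : L -> btree E' L') t :
  f =1 g -> graft f t = graft g t.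
Proof. by move=> fg; elim: t => //= e l -> r ->. Qed.

Lemma ntree_uniq (E' : Type) n (t : btree E' 'I_n) :
  uniq (leaves t) -> (forall i, i \in leaves t) -> perm_eq (leaves t) (enum 'I_n).
Proof.
move=> ut it; apply: uniq_perm; rewrite ?enum_uniq // => i.
by rewrite it mem_enum.
Qed.

Definition cor (e : E) : btree E 'I_2 := Node e (Leaf ord0) (Leaf ord_max).

Lemma cor_ntree e : is_ntree (cor e).
Proof. by apply: ntree_uniq => // i; rewrite !inE; case: i => [[|[]]]. Qed.

(** * Adding one vertex to a tree, in place of a leaf or at the root *)

Section Step.
Variables (m : nat) (i : 'I_m).
Let f : 'I_m -> 'I_m.+1 := widen_ord (leqnSn m).
Let g (j : 'I_2) : 'I_m.+1 := if j == ord0 then f i else ord_max.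

Lemma widen_max_neq j : f j != ord_max.
Proof. by rewrite -val_eqE /= neq_ltn ltn_ord. Qed.

Lemma widen_inj : injective f.
Proof. by move=> x y /(congr1 val) /= /val_inj. Qed.

Lemma widen_or_max (j : 'I_m.+1) : (j = ord_max) + {j' | j = f j'}.
Proof.
have [jm|jm] := ltnP j m; [right|left].
  by exists (Ordinal jm); apply: val_inj.
by apply: val_inj; apply/eqP; rewrite eqn_leq jm -ltnS ltn_ord.
Qed.

Lemma step_inner_ntree e (s : btree E 'I_m) :
  is_ntree s -> is_ntree (pcomp_tree i f g s (cor e)).
Proof.
move=> ns; have cnt := ntree_count (exist _ s ns).
have lvE : leaves (pcomp_tree i f g s (cor e)) =
   flatten [seq if j == i then [:: f i; ord_max] else [:: f j] | j <- leaves s].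
  rewrite leaves_graft; congr flatten; apply: eq_map => j.
  by case: eqP => // ->; rewrite /= /g.
apply/allP => j0 _; apply/eqP; rewrite -/(count_mem j0 _).
rewrite lvE [RHS]count_uniq_mem ?enum_uniq // mem_enum /=.
rewrite count_flatten -map_comp.
have [->|[j ->]] := widen_or_max j0; last first.
  rewrite -(cnt j) /= -sumn_count; congr sumn; apply: eq_map => j' /=.
  have [->|_] /= := eqVneq j' i; rewrite (inj_eq widen_inj) addn0 //.
  by rewrite [_ == widen_ord _ _]eq_sym (negbTE (widen_max_neq _)) addn0.
rewrite -(cnt i) /= -sumn_count; congr sumn; apply: eq_map => j' /=.
by have [_|_] /= := eqVneq j' i; rewrite ?eqxx ?(negbTE (widen_max_neq _)).
Qed.

Lemma step_outer_ntree e (s : btree E 'I_m) (t := tlabel f s) :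
  is_ntree s -> is_ntree (Node e t (Leaf ord_max)) && is_ntree (Node e (Leaf ord_max) t).
Proof.
move=> ns; suff h : is_ntree (Node e t (Leaf ord_max)).
  by rewrite h /is_ntree /=; move: h; rewrite /is_ntree /= perm_sym -cat1s => h;
     rewrite perm_sym (perm_trans h) // perm_catC.
apply: ntree_uniq => /=.
  rewrite cats1 rcons_uniq leaves_tlabel (map_inj_uniq widen_inj).
  rewrite (perm_uniq ns) enum_uniq andbT; apply/mapP => -[j _ /eqP].
  by rewrite eq_sym (negbTE (widen_max_neq _)).
move=> j; rewrite mem_cat inE leaves_tlabel.
have [->|[j' ->]] := widen_or_max j; first by rewrite eqxx orbT.
by rewrite map_f // (perm_mem ns) mem_enum.
Qed.
End Step.

Section Ideal.
Variable R : free_op E 3 -> Prop.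
Local Notation ideal := (@ideal k E R).

Lemma ideal_relabel_fun m n (f : 'I_m -> 'I_n) x : ideal x -> ideal (relabel f x).
Proof.
case: m f x => [|m] f x ix; last by rewrite relabel_pcomp; apply: ideal_compl.
by rewrite [x]free0_eq0 linear0; apply: ideal_zero.
Qed.

(** Simultaneous substitution is built from partial compositions, by induction on the number of
    vertices in the trees [h i]. Without vertices it is a relabelling; otherwise the root of one
    [h i] is moved into [x] as a corolla at the input [i], and its two subtrees remain to be
    substituted. *)
Lemma ideal_gsub m n (h : 'I_m -> btree E 'I_n) x : ideal x -> ideal (gsub h x).
Proof.
move: {2}(\sum_i nodes (h i))%N (leqnn (\sum_i nodes (h i))%N) => N.
elim: N m h x => [|N IH] m h x.
  rewrite leqn0 sum_nat_eq0 => /forallP h0 ix.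
  have leafh i : {j | h i = Leaf j}.
    by have := h0 i; case: (h i) => //= j _; exists j.
  pose f i := sval (leafh i).
  suff -> : gsub h x = relabel f x by apply: ideal_relabel_fun.
  apply: (free_lin_eq (F := gsub h) (G := relabel f)) => t nt /=.
  rewrite gsub_mono // relabel_mono //.
  by congr mono; apply: graft_ext => i; rewrite /f; case: (leafh i).
move=> hN ix.
have [[i hi]|nex] := pselect (exists i, (0 < nodes (h i))%N); last first.
  apply: IH => //; rewrite big1 // => i _; apply/eqP.
  by rewrite -leqn0 leqNgt; apply/negP => hi; apply: nex; exists i.
case Eh: (h i) hi => [|e l r] // _.
pose f : 'I_m -> 'I_m.+1 := widen_ord (leqnSn m).
pose g (j : 'I_2) : 'I_m.+1 := if j == ord0 then f i else ord_max.
(* The two inputs of the corolla carry the labels [i] and [ord_max]; they receive the left and the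
   right subtree of [h i]. *)
pose h' j := match widen_or_max j with
  | inl _ => r
  | inr (exist j' _) => if j' == i then l else h j' end.
have h'f j : h' (f j) = if j == i then l else h j.
  rewrite /h'; case: widen_or_max => [eq|[j' eq]].
    by have := widen_max_neq j; rewrite -/f eq eqxx.
  by rewrite (widen_inj eq).
have h'm : h' ord_max = r.
  rewrite /h'; case: widen_or_max => // -[j' eq].
  by have := widen_max_neq j'; rewrite -eq eqxx.
have -> : gsub h x = gsub h' (pcompl i f g (mono (cor e)) x).
  apply: (@free_lin_eq _ _ (gsub h) (gsub h' \o pcompl i f g (mono (cor e)))) => t nt /=.
  rewrite /pcompl pcomp_mono ?cor_ntree // !gsub_mono //; last exact: step_inner_ntree.
  congr mono; rewrite graft_graft; apply: graft_ext => j.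
  case: (eqVneq j i) => [->|ji] /=; last by rewrite h'f (negbTE ji).
  by rewrite Eh /g /= h'm h'f eqxx.
apply: IH; last exact: ideal_compl.
rewrite big_ord_recr h'm /= -ltnS; apply: leq_trans hN.
rewrite (bigD1 i) //= [in X in (_ < X)%N](bigD1 i) //= Eh /=.
under eq_bigr do rewrite -/(f _) h'f; rewrite -/(f _) h'f eqxx.
rewrite (eq_bigr (fun j => nodes (h j))) => [|j /negbTE -> //].
lia.
Qed.
End Ideal.
End Substitution.
(** * Instances of relations in a context, commutative associative operations *)

Section Contexts.
Variables (k : fieldType) (E : sig2mod k).

Lemma plug_lin L (K : ctx E L) a t t1 t2 :
  lin_rel a t t1 t2 -> lin_rel a (plug K t) (plug K t1) (plug K t2).
Proof.
by elim: K t t1 t2 => //= [e K IH r|e l K IH] t t1 t2 h; apply: IH; constructor.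
Qed.

Lemma plug_swap L (K : ctx E L) t t' :
  swap_rel t t' -> swap_rel (plug K t) (plug K t').
Proof.
by elim: K t t' => //= [e K IH r|e l K IH] t t' h; apply: IH; constructor.
Qed.

Section Ksub.
Variables (m n : nat) (K : ctx E 'I_n) (h : 'I_m -> btree E 'I_n).

Definition ksub (x : free_op E m) : free_op E n :=
  linext (fun t : ntree E m => mono (plug K (graft h (val t)))) (qrepr x).

Lemma ksubE u : ksub (qclass (@free_rel k E m) u) =
  linext (fun t : ntree E m => mono (plug K (graft h (val t)))) u.
Proof.
apply: (free_descE (h := fun t => mono (plug K (graft h t)))) => [a t t1 t2 r|t t' r].
  exact/mono_lin/plug_lin/graft_lin.
exact/mono_swap/plug_swap/graft_swap.
Qed.

Fact ksub_linear : linear ksub.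
Proof.
move=> a x y; rewrite -[x]qreprK -[y]qreprK -linearP !ksubE.
exact: linext_linear.
Qed.

HB.instance Definition _ :=
  GRing.isLinear.Build k (free_op E m) (free_op E n) *:%R ksub ksub_linear.

Lemma ksub_mono t : is_ntree t -> ksub (mono t) = mono (plug K (graft h t)).
Proof.
by move=> nt; rewrite ksubE; apply: (linext_tvec (fun t => mono (plug K (graft h t)))).
Qed.
End Ksub.

Section Extend.
Variables (m : nat) (X : Type) (h : 'I_m -> X) (x : X).

Definition extend (j : 'I_m.+1) : X :=
  if widen_or_max j is inr (exist j' _) then h j' else x.

Lemma extend_widen j : extend (widen_ord (leqnSn m) j) = h j.
Proof.
rewrite /extend; case: widen_or_max => [e|[j' e]]; last by rewrite (widen_inj e).
by have := widen_max_neq j; rewrite e eqxx.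
Qed.

Lemma extend_max : extend ord_max = x.
Proof.
rewrite /extend; case: widen_or_max => // -[j' e].
by have := widen_max_neq j'; rewrite -e eqxx.
Qed.
End Extend.

Lemma graft_extend m n (h : 'I_m -> btree E 'I_n) r (t : btree E 'I_m) :
  graft (extend h r) (tlabel (widen_ord (leqnSn m)) t) = graft h t.
Proof. by rewrite /tlabel graft_graft; apply: graft_ext => j; apply: extend_widen. Qed.

Section CtxIdeal.
Variable R : free_op E 3 -> Prop.

(** The innermost vertex of the context is absorbed by composing a corolla with [x]; the sibling
    subtree is then substituted for the new last input. Induction on the context reduces to
    substitution alone. *)
Lemma ideal_ksub m n (K : ctx E 'I_n) (h : 'I_m -> btree E 'I_n) x :
  ideal R x -> ideal R (ksub K h x).
Proof.
elim: K m h x => [|e K IH r|e l K IH] m h x ix.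
- suff -> : ksub Hole h x = gsub h x by apply: ideal_gsub.
  apply: (free_lin_eq (F := ksub Hole h) (G := gsub h)) => t nt /=.
  by rewrite ksub_mono // gsub_mono.
(* The map [fun=> ord_max] labels the one input of the corolla that remains free. *)
- pose P := @pcompr k E 2 m m.+1 ord0 (fun=> ord_max) (widen_ord (leqnSn m)) (mono (cor e)).
  have -> : ksub (CtxL e K r) h x = ksub K (extend h r) (P x).
    apply: (free_lin_eq (F := ksub (CtxL e K r) h) (G := ksub K (extend h r) \o P)) => t nt /=.
    rewrite /P /pcompr pcomp_mono ?cor_ntree // !ksub_mono //; last first.
      by have /andP[] := step_outer_ntree e nt.
    congr (mono (plug K (Node _ _ _))); last by rewrite /= extend_max.
    by rewrite /= -/(graft _ _) graft_extend.
  by apply: IH; apply: ideal_compr.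
- pose P := @pcompr k E 2 m m.+1 ord_max (fun=> ord_max) (widen_ord (leqnSn m)) (mono (cor e)).
  have -> : ksub (CtxR e l K) h x = ksub K (extend h l) (P x).
    apply: (free_lin_eq (F := ksub (CtxR e l K) h) (G := ksub K (extend h l) \o P)) => t nt /=.
    rewrite /P /pcompr pcomp_mono ?cor_ntree // !ksub_mono //; last first.
      by have /andP[] := step_outer_ntree e nt.
    congr (mono (plug K (Node _ _ _))); first by rewrite /= extend_max.
    by rewrite /= -/(graft _ _) graft_extend.
  by apply: IH; apply: ideal_compr.
Qed.

Definition oclass n (x : free_op E n) : operad R n := qclass _ x.

Lemma oclass_ideal n x : ideal R x -> oclass x = 0 :> operad R n.
Proof.
move=> ix; rewrite -[RHS](raddf0 (qclass (@ideal _ _ R n))).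
by apply/qclass_eq/lspan_gen; rewrite subr0.
Qed.

Lemma oclass_ksub m n (K : ctx E 'I_n) (h : 'I_m -> btree E 'I_n) x :
  ideal R x -> oclass (ksub K h x) = 0.
Proof. by move=> ix; apply/oclass_ideal/ideal_ksub. Qed.

Variable n : nat.
Implicit Types (S T U : btree E 'I_n) (K : ctx E 'I_n).

(** Quantifying over contexts makes this a congruence and gives it content on proper subtrees, whose
    own class is 0 for lack of labels. *)
Definition teq S T := forall K, omono R (plug K S) = omono R (plug K T).

Lemma teq_sym S T : teq S T -> teq T S. Proof. by move=> h K. Qed.
Lemma teq_trans T S U : teq S T -> teq T U -> teq S U.
Proof. by move=> h h' K; rewrite h. Qed.

Lemma teq_node e S S' T T' :
  teq S S' -> teq T T' -> teq (Node e S T) (Node e S' T').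
Proof.
move=> h h' K; transitivity (omono R (plug K (Node e S' T))).
  exact: (h (CtxL e K T)).
exact: (h' (CtxR e S' K)).
Qed.

Section CommAssoc.
Variable e : E.
Hypothesis comm : swap e = e.
Hypothesis assoc : ideal R
  (mono (Node e (Node e (Leaf leaf0) (Leaf leaf1)) (Leaf leaf2))
   - mono (Node e (Leaf leaf0) (Node e (Leaf leaf1) (Leaf leaf2)))).

Lemma teq_comm S T : teq (Node e S T) (Node e T S).
Proof.
move=> K; congr (qclass _ _); apply/mono_swap/plug_swap.
by rewrite -{1}comm; constructor.
Qed.

Lemma ntree3l (E' : sig2mod k) (e1 e2 : E') :
  is_ntree (Node e1 (Node e2 (Leaf leaf0) (Leaf leaf1)) (Leaf leaf2)).
Proof. by apply: ntree_uniq => // -[[|[|[]]]]. Qed.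

Lemma ntree3r (E' : sig2mod k) (e1 e2 : E') :
  is_ntree (Node e1 (Leaf leaf0) (Node e2 (Leaf leaf1) (Leaf leaf2))).
Proof. by apply: ntree_uniq => // -[[|[|[]]]]. Qed.

Definition sub3 (X : Type) (S0 S1 S2 : X) (i : 'I_3) : X := nth S0 [:: S0; S1; S2] i.

Lemma teq_assoc S T U :
  teq (Node e (Node e S T) U) (Node e S (Node e T U)).
Proof.
move=> K; apply/eqP; rewrite -subr_eq0 -raddfB; apply/eqP.
have := oclass_ksub K (sub3 S T U) assoc.
by rewrite linearB /= !ksub_mono ?ntree3l ?ntree3r.
Qed.

Lemma leaves_cons (E' X : Type) (t : btree E' X) : exists x s, leaves t = x :: s.
Proof.
elim: t => [x|e0 l [x [s El]] r _]; first by exists x, [::].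
by exists x, (s ++ leaves r); rewrite /= El.
Qed.

Fixpoint comb S (s : seq (btree E 'I_n)) :=
  if s is T :: s' then Node e S (comb T s') else S.

Lemma comb_cat S s T s' : teq (Node e (comb S s) (comb T s')) (comb S (s ++ T :: s')).
Proof.
elim: s S => [|U s IH] S //=.
by apply: teq_trans (teq_assoc _ _ _) _; apply: teq_node.
Qed.

(** Induction on the length. If the heads differ, the induction hypothesis brings [T] to the second
    place on the left and [S] to the second place on the right; then the two leading factors are
    exchanged. *)
Lemma comb_perm S s T s' : perm_eq (S :: s) (T :: s') -> teq (comb S s) (comb T s').
Proof.
have [N] := ubnP (size s); elim: N S s T s' => // N IH S s T s' /=.
rewrite ltnS => sN p; have sz := perm_size p.
have [ST|ST] := eqVneq S T.
  subst T; move: p; rewrite perm_cons => p.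
  case: s s' sN sz p => [|U s] [|U' s'] //= sN _ p.
  by apply: teq_node => //; apply: IH.
have Ts : T \in s.
  by have := perm_mem p T; rewrite !inE eqxx eq_sym (negbTE ST).
have ps : perm_eq s (T :: rem T s) by apply: perm_to_rem.
have ps' : perm_eq s' (S :: rem T s).
  rewrite -(perm_cons T) perm_sym.
  apply: perm_trans p; rewrite -cat1s -[S :: rem _ _]cat1s perm_catCA /=.
  by rewrite perm_cons perm_sym.
have h1 : teq (comb S s) (comb S (T :: rem T s)).
  case: s sN {sz p ps'} Ts ps => [|U s] //= sN Ts ps.
  by apply: teq_node => //; apply: IH.
have h2 : teq (comb T s') (comb T (S :: rem T s)).
  case: s' {p} sz ps' => [|U s'] /= sz ps'; first by have := perm_size ps'.
  apply: teq_node => //; apply: IH ps'; case: sz => sz.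
  by rewrite -sz.
apply: teq_trans h1 _; apply: teq_trans (teq_sym h2) => /=.
case: (rem T s) => [|U r] /=; first exact: teq_comm.
apply: teq_trans (teq_sym (teq_assoc _ _ _)) _.
by apply: teq_trans (teq_assoc _ _ _); apply: teq_node => //; apply: teq_comm.
Qed.

Definition cmb X (F : X -> btree E 'I_n) (t : btree unit X) :=
  graft F (tdecor (fun=> e) t).

Lemma cmb_comb X F (t : btree unit X) S s :
  map F (leaves t) = S :: s -> teq (cmb F t) (comb S s).
Proof.
elim: t S s => [x|[] l IHl r IHr] S s /=; first by case=> <- <-.
have [x [xs El]] := leaves_cons l; have [y [ys Er]] := leaves_cons r.
rewrite map_cat El Er /= => -[<- <-].
apply: teq_trans (comb_cat _ _ _ _).
by apply: teq_node; [apply: IHl; rewrite El | apply: IHr; rewrite Er].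
Qed.

(** Both trees are rebracketed into right combs, whose factors may be permuted: the coherence of a
    commutative associative operation. *)
Lemma cmb_perm (X : eqType) F (t t' : btree unit X) :
  perm_eq (leaves t) (leaves t') -> teq (cmb F t) (cmb F t').
Proof.
move=> p; have [x [xs E1]] := leaves_cons t; have [y [ys E2]] := leaves_cons t'.
apply: (teq_trans (T := comb (F x) (map F xs))).
  by apply: cmb_comb; rewrite E1.
apply: (teq_trans (T := comb (F y) (map F ys))).
  by apply: comb_perm; rewrite -!map_cons -E1 -E2; apply: perm_map.
by apply/teq_sym/cmb_comb; rewrite E2.
Qed.

Lemma cmb_teq (X : Type) F G (t : btree unit X) :
  (forall x, teq (F x) (G x)) -> teq (cmb F t) (cmb G t).
Proof. by move=> FG; elim: t => //= *; apply: teq_node. Qed.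

End CommAssoc.
End CtxIdeal.
End Contexts.
(** The linearity relation concerns decorations [a *: e1 + e2]; to use it for [c *: e] one also
    needs that a vertex decorated by 0 gives 0, which is its instance with scalar -1 and all
    decorations 0. *)
Lemma mono_plug_scale (k : fieldType) (E : sig2mod k) n (K : ctx E 'I_n) c e S T :
  mono (plug K (Node (c *: e) S T)) = c *: mono (plug K (Node e S T)).
Proof.
have := @mono_lin k E n c (plug K (Node (c *: e) S T)) (plug K (Node e S T)) (plug K (Node 0 S T)).
rewrite -[c *: e]addr0 => -> /=; last by apply/plug_lin/lin_root.
suff -> : mono (plug K (Node 0 S T)) = 0 by rewrite addr0.
have := @mono_lin k E n (-1) (plug K (Node 0 S T)) (plug K (Node 0 S T)) (plug K (Node 0 S T)).
rewrite scaleN1r addNr; apply; apply: plug_lin.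
by rewrite -{1}[0](addNr 0) -scaleN1r; apply: lin_root.
Qed.

(** * Two-level trees and partitions *)

Section Flat.
Variables (k : fieldType) (E : sig2mod k) (R : free_op E 3 -> Prop) (n : nat).

Notation forest := (btree unit (btree unit 'I_n)).
Implicit Types (t : forest) (S : btree unit 'I_n).

(** The outer shape is a bracketing for [b]; its leaves are bracketings for [a], one for each
    block. *)
Definition flat (a b : E) t := cmb b (cmb a (@Leaf E 'I_n)) t.
Definition labels t := flatten [seq leaves u | u <- leaves t].
Definition is_nforest t := perm_eq (labels t) (enum 'I_n).
Definition block S : {set 'I_n} := [set i in leaves S].
Definition parts t : {set {set 'I_n}} :=
  [set A in [seq block u | u <- leaves t]].

Lemma leaves_tdecor E1 E2 L (h : E1 -> E2) (t : btree E1 L) :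
  leaves (tdecor h t) = leaves t.
Proof. by elim: t => //= e l -> r ->. Qed.

Lemma leaves_cmb (e : E) X (F : X -> btree E 'I_n) (t : btree unit X) :
  leaves (cmb e F t) = flatten [seq leaves (F x) | x <- leaves t].
Proof. by rewrite leaves_graft leaves_tdecor. Qed.

Lemma leaves_flat a b t : leaves (flat a b t) = labels t.
Proof.
rewrite leaves_cmb; congr flatten; apply: eq_map => S.
by rewrite leaves_cmb /= flatten_seq1.
Qed.

Lemma is_ntree_flat a b t : is_ntree (flat a b t) = is_nforest t.
Proof. by rewrite /is_ntree leaves_flat. Qed.

Lemma uniq_flatten_in (X Y : eqType) (F : X -> seq Y) s x :
  uniq (flatten (map F s)) -> x \in s -> uniq (F x).
Proof.
elim: s => //= y s IH; rewrite cat_uniq inE => /and3P[uy _ us].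
by case/predU1P => [-> //|]; apply: IH.
Qed.

Lemma uniq_flatten_map (X Y Z : eqType) (F : X -> seq Y) (G : X -> Z) s :
    (forall x, F x <> [::]) -> (forall x y, G x = G y -> F x =i F y) ->
  uniq (flatten (map F s)) -> uniq (map G s).
Proof.
move=> F0 GF; elim: s => //= x s IH; rewrite cat_uniq => /and3P[_ /hasPn h us].
rewrite IH // andbT; apply/mapP => -[y ys /GF Fxy].
case Fx: (F x) (F0 x) => [//|z r] _.
have zx : z \in F x by rewrite Fx inE eqxx.
suff /h : z \in flatten (map F s) by rewrite /= zx.
by apply/flattenP; exists (F y); [apply: map_f | rewrite -Fxy].
Qed.

Lemma leaves_neq0 (E' X : Type) (t : btree E' X) : leaves t <> [::].
Proof. by have [x [s ->]] := leaves_cons t. Qed.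

(** A planar shape depending only on the set of leaves. *)
Definition canon S := choose (fun S' => perm_eq (leaves S) (leaves S')) S.

Lemma canonP S : perm_eq (leaves S) (leaves (canon S)).
Proof. exact: (@chooseP _ (fun S' => perm_eq (leaves S) (leaves S'))). Qed.

Lemma canon_eq S S' : perm_eq (leaves S) (leaves S') -> canon S = canon S'.
Proof.
move=> p; rewrite /canon.
have e : (fun S0 : btree unit 'I_n => perm_eq (leaves S) (leaves S0)) =1
         (fun S0 => perm_eq (leaves S') (leaves S0)).
  by move=> S0; apply/(permPl p).
by rewrite (eq_choose e); apply: choose_id; rewrite ?perm_refl // perm_sym.
Qed.

Lemma nforest_uniq t : is_nforest t -> uniq (labels t).
Proof. by move/perm_uniq->; apply: enum_uniq. Qed.

(** The trees at the leaves of a forest have disjoint nonempty sets of labels, so the lists of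
    canonical shapes are duplicate-free and it is enough to compare them as sets. *)
Lemma canon_parts t t' : is_nforest t -> is_nforest t' -> parts t = parts t' ->
  perm_eq (map canon (leaves t)) (map canon (leaves t')).
Proof.
move=> nt nt' pE.
have canF S S' : canon S = canon S' -> leaves S =i leaves S'.
  by move=> cE; apply: perm_mem; rewrite (permPl (canonP S)) cE perm_sym canonP.
have sub u u' : is_nforest u -> is_nforest u' -> parts u = parts u' ->
    {subset map canon (leaves u) <= map canon (leaves u')}.
  move=> nu nu' e _ /mapP[S Su ->].
  have : block S \in parts u by rewrite inE map_f.
  rewrite e inE => /mapP[S' Su' bE]; apply/mapP; exists S' => //.
  apply: canon_eq; apply: uniq_perm.
  - exact: (uniq_flatten_in (nforest_uniq nu)).
  - exact: (uniq_flatten_in (nforest_uniq nu')).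
  - by move=> i; move/setP/(_ i): bE; rewrite !inE.
apply: uniq_perm => [||S]; last by apply/idP/idP; apply: sub.
  by apply: uniq_flatten_map canF (nforest_uniq nt) => S; apply: leaves_neq0.
by apply: uniq_flatten_map canF (nforest_uniq nt') => S; apply: leaves_neq0.
Qed.

Variables a b : E.
Hypotheses (a_comm : swap a = a) (b_comm : swap b = b).
Hypothesis a_assoc : ideal R
  (mono (Node a (Node a (Leaf leaf0) (Leaf leaf1)) (Leaf leaf2))
   - mono (Node a (Leaf leaf0) (Node a (Leaf leaf1) (Leaf leaf2)))).
Hypothesis b_assoc : ideal R
  (mono (Node b (Node b (Leaf leaf0) (Leaf leaf1)) (Leaf leaf2))
   - mono (Node b (Leaf leaf0) (Node b (Leaf leaf1) (Leaf leaf2)))).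

(** Commutativity and associativity of [a] give each block its canonical shape; the resulting lists
    of blocks differ by a permutation, which those of [b] absorb. *)
Lemma flat_coherence t t' : is_nforest t -> is_nforest t' ->
  parts t = parts t' -> teq R (flat a b t) (flat a b t').
Proof.
move=> nt nt' pE.
have canonE u : teq R (flat a b u) (cmb b (cmb a (@Leaf E 'I_n)) (tlabel canon u)).
  rewrite /cmb /tlabel; have -> : tdecor (fun=> b) (graft (fun i => Leaf (canon i)) u) =
     graft (fun i => Leaf (canon i)) (tdecor (fun=> b) u).
    by elim: u => //= _ l -> r ->.
  rewrite graft_graft; apply: cmb_teq => S /=.
  exact/cmb_perm/canonP.
apply: teq_trans (canonE t) _; apply: teq_trans (teq_sym (canonE t')).
by apply: cmb_perm => //; rewrite !leaves_tlabel; apply: canon_parts.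
Qed.

(** The class of the product, over the blocks [A] of the partition [p], of the
    products of the elements of [A] (zero if [p] is not a partition). *)
Definition part_class (p : {set {set 'I_n}}) : operad R n :=
  if pselect (exists t, is_nforest t /\ parts t = p) is left h
  then omono R (flat a b (projT1 (cid h))) else 0.

Lemma part_classE t : is_nforest t -> omono R (flat a b t) = part_class (parts t).
Proof.
move=> nt; rewrite /part_class; case: pselect => [h|[]]; last by exists t.
by case: (cid h) => t' /= [nt' e]; apply: (flat_coherence nt nt' _ Hole).
Qed.

Definition tscal c (S T : btree E 'I_n) :=
  forall K, omono R (plug K S) = c *: omono R (plug K T).

Lemma tscal_node e c c' (S S' T T' : btree E 'I_n) : tscal c S S' -> tscal c' T T' ->
  tscal (c * c') (Node e S T) (Node e S' T').
Proof.
move=> h h' K; have /= -> := h (CtxL e K T).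
by have /= -> := h' (CtxR e S' K); rewrite scalerA.
Qed.

Lemma tscal_deco e c (S T : btree E 'I_n) : tscal c (Node (c *: e) S T) (Node e S T).
Proof.
by move=> K; rewrite -linearZ; congr (qclass _ _); apply: mono_plug_scale.
Qed.

Lemma tscal_trans c c' (S T U : btree E 'I_n) : tscal c S T -> tscal c' T U -> tscal (c * c') S U.
Proof. by move=> h h' K; rewrite h h' scalerA. Qed.

Fixpoint tcoef X (t : btree k X) : k :=
  if t is Node c l r then c * tcoef l * tcoef r else 1.

Definition shape X (E' : Type) : btree E' X -> btree unit X := tdecor (fun=> tt).

(** Collects the scalars of a tree whose vertices are multiples of one generator [e], and those of
    the trees grafted on it. It serves for Com itself and for each level of a composite. *)
Lemma tscal_graft X (F G : X -> btree E 'I_n) (c : X -> k) (h : k -> E) e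
    (t : btree k X) : (forall a, h a = a *: e) ->
    (forall x, tscal (c x) (F x) (G x)) ->
  tscal (tcoef t * \prod_(x <- leaves t) c x) (graft F (tdecor h t)) (cmb e G (shape t)).
Proof.
move=> hE FG; elim: t => [x|q l IHl r IHr] /=; first by rewrite mul1r big_seq1.
rewrite big_cat /= hE.
have -> : q * tcoef l * tcoef r * ((\prod_(i <- leaves l) c i) * (\prod_(i <- leaves r) c i))
  = q * ((tcoef l * \prod_(i <- leaves l) c i) * (tcoef r * \prod_(i <- leaves r) c i)).
  by ring.
apply: tscal_trans (tscal_deco _ _ _ _) _.
exact: tscal_node.
Qed.

End Flat.
(** * Evaluation in algebras *)

Section Evaluation.
Variables (k : fieldType) (E : sig2mod k) (V : lmodType k) (op : E -> V -> V -> V).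
Hypothesis op_e : forall x y, linear (fun e => op e x y).
Hypothesis op_l : forall e y, linear (fun x => op e x y).
Hypothesis op_r : forall e x, linear (op e x).
Hypothesis op_swap : forall e x y, op (swap e) x y = op e y x.

Fixpoint teval L (v : L -> V) (t : btree E L) : V :=
  match t with
  | Leaf i => v i
  | Node e l r => op e (teval v l) (teval v r)
  end.

Lemma teval_lin_rel L (v : L -> V) a t t1 t2 :
  lin_rel a t t1 t2 -> teval v t = a *: teval v t1 + teval v t2.
Proof.
by elim=> {t t1 t2} /= [e1 e2 l r|e l l1 l2 r _ ->|e l r r1 r2 _ ->];
  rewrite ?op_e ?op_l ?op_r.
Qed.

Lemma teval_swap_rel L (v : L -> V) t t' : swap_rel t t' -> teval v t = teval v t'.
Proof.
by elim=> {t t'} /= [e l r|e l l' r _ ->|e l r r' _ ->] //; rewrite op_swap.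
Qed.

Lemma teval_graft L L' (f : L -> btree E L') v t :
  teval v (graft f t) = teval (fun i => teval v (f i)) t.
Proof. by elim: t => //= e l -> r ->. Qed.

Lemma teval_eq_in (L : eqType) (v v' : L -> V) t :
  {in leaves t, v =1 v'} -> teval v t = teval v' t.
Proof.
elim: t => [j|e l IHl r IHr] /= hh'; first by apply: hh'; rewrite inE.
by rewrite IHl ?IHr // => j js; apply: hh'; rewrite mem_cat js ?orbT.
Qed.

Lemma teval_lin_at (L : eqType) a i (v v1 v2 : L -> V) t :
    (forall j, j != i -> v1 j = v j /\ v2 j = v j) ->
    v i = a *: v1 i + v2 i -> count_mem i (leaves t) = 1%N ->
  teval v t = a *: teval v1 t + teval v2 t.
Proof.
move=> hne hi; elim: t => [j|e l IHl r IHr] /=.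
  by rewrite addn0; case: eqP => // ->.
have same (s : btree E L) : count_mem i (leaves s) = 0%N ->
    teval v1 s = teval v s /\ teval v2 s = teval v s.
  move/eqP; rewrite -leqn0 leqNgt -has_count has_pred1 => si.
  by split; apply: teval_eq_in => j jt;
    have /hne[] : j != i by apply: contraNneq si => <-.
rewrite count_cat; case cl: (count_mem i (leaves l)) => [|c].
  by move=> cr; have [-> ->] := same _ cl; rewrite IHr // op_r.
case: c cl => [|c] cl //; rewrite add1n => -[cr].
by have [-> ->] := same _ cr; rewrite IHl // op_l.
Qed.

Section Eval.
Variables (n : nat) (v : 'I_n -> V).

Definition eval (x : free_op E n) : V :=
  linext (fun t : ntree E n => teval v (val t)) (qrepr x).

Fact eval_linear : linear eval.
Proof.
have evalE u : eval (qclass (@free_rel k E n) u) =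
    linext (fun t : ntree E n => teval v (val t)) u.
  apply: (free_descE (h := teval v)) => [a t t1 t2 r|t t' r].
    exact: teval_lin_rel.
  exact: teval_swap_rel.
move=> a x y; rewrite -[x]qreprK -[y]qreprK -linearP !evalE.
exact: linext_linear.
Qed.

Definition eval_lin := lin_of eval_linear.

Lemma eval_mono t : is_ntree t -> eval (mono t) = teval v t.
Proof.
move=> nt; rewrite /eval (free_descE (h := teval v)); last first.
- exact: teval_swap_rel.
- exact: teval_lin_rel.
exact: (linext_tvec (teval v)).
Qed.
End Eval.

(** Up to order, the leaves of a composite do not depend on the two trees: for given [i], [f], [g],
    either all composites are bijectively labelled or all of them vanish. *)
Lemma leaves_pcomp m p n (i : 'I_m) (f : 'I_m -> 'I_n) (g : 'I_p -> 'I_n)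
    (s : btree E 'I_m) (t : btree E 'I_p) : is_ntree s -> is_ntree t ->
  perm_eq (leaves (pcomp_tree i f g s t))
    (flatten [seq if j == i then map g (enum 'I_p) else [:: f j] | j <- enum 'I_m]).
Proof.
move=> ns nt; rewrite leaves_graft.
apply: (@perm_trans _ (flatten
  [seq if j == i then map g (enum 'I_p) else [:: f j] | j <- leaves s])).
  elim: (leaves s) => //= j r IH; apply: perm_cat IH.
  by case: eqP => // _; rewrite leaves_tlabel; apply: perm_map.
by apply: perm_flatten; apply: perm_map.
Qed.

Lemma linext0 (G : choiceType) (W : lmodType k) (f : G -> W) u :
  (forall g, f g = 0) -> linext f u = 0.
Proof. by move=> f0; apply: big1 => g _; rewrite f0 scaler0. Qed.

(** By induction on the ideal: evaluating a composite amounts to evaluating [x] with the value of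
    the second factor at the input [i], or to applying a linear map to the value of [y]. *)
Lemma eval_ideal (R : free_op E 3 -> Prop) :
    (forall x, R x -> forall v, eval v x = 0) ->
  forall n (x : free_op E n), ideal R x -> forall v, eval v x = 0.
Proof.
move=> R0 n x; elim=> {n x} [x Rx|n|n a x y _ hx _ hy|m p n i f g x y _ hx|m p n i f g x y _ hy] v.
- exact: R0.
- exact: (linear0 (eval_lin v)).
- by rewrite (eval_linear v) /= hx hy scaler0 addr0.
- rewrite [y]free_linext -/(pcompr i f g x _).
  rewrite (linear_linext (pcompr i f g x)) -[eval v _]/(eval_lin v _) linear_linext.
  apply: linext0 => -[t nt] /=.
  pose ok := perm_eq (flatten [seq if j == i then map g (enum 'I_p) else [:: f j]
    | j <- enum 'I_m]) (enum 'I_n).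
  have [ok1|ok1] := boolP ok; last first.
    suff -> : pcompr i f g x (mono t) = 0 by exact: (linear0 (eval_lin v)).
    apply: (free_lin_eq (F := pcompl i f g (mono t)) (G := \0%R)) => s ns /=.
    rewrite /pcompl pcomp_mono // mono_eq0 // /is_ntree.
    by rewrite (permPl (leaves_pcomp i f g ns nt)).
  pose v' j := if j == i then teval (v \o g) t else v (f j).
  rewrite -(hx v'); apply: (free_lin_eq (F := eval_lin v \o pcompl i f g (mono t))
    (G := eval_lin v')) => s ns /=.
  rewrite /pcompl pcomp_mono // !eval_mono //; last first.
    by rewrite /is_ntree (permPl (leaves_pcomp i f g ns nt)).
  rewrite teval_graft; apply: teval_eq_in => j _; rewrite /v'.
  by case: eqP => // _; rewrite teval_graft.
- rewrite [x]free_linext -/(pcompl i f g y _).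
  rewrite (linear_linext (pcompl i f g y)) -[eval v _]/(eval_lin v _) linear_linext.
  apply: linext0 => -[s ns] /=.
  pose ok := perm_eq (flatten [seq if j == i then map g (enum 'I_p) else [:: f j]
    | j <- enum 'I_m]) (enum 'I_n).
  have [ok1|ok1] := boolP ok; last first.
    suff -> : pcompl i f g y (mono s) = 0 by exact: (linear0 (eval_lin v)).
    apply: (free_lin_eq (F := pcompr i f g (mono s)) (G := \0%R)) => t nt /=.
    rewrite /pcompr pcomp_mono // mono_eq0 // /is_ntree.
    by rewrite (permPl (leaves_pcomp i f g ns nt)).
  (* The tree [s] as a function of the value at its input [i], linear because [i] labels a single
     leaf. *)
  pose M0 (w : V) := teval (fun j => if j == i then w else v (f j)) s.
  have M0lin : linear M0.
    move=> a w w'; apply: (@teval_lin_at _ a i) => [j /negbTE->//||].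
      by rewrite eqxx.
    exact: (ntree_count (exist _ s ns)).
  pose M := lin_of M0lin.
  rewrite -[RHS](linear0 M) -(hy (v \o g)).
  apply: (free_lin_eq (F := eval_lin v \o pcompr i f g (mono s))
    (G := M \o eval_lin (v \o g))) => t nt /=.
  rewrite /pcompr pcomp_mono // !eval_mono //; last first.
    by rewrite /is_ntree (permPl (leaves_pcomp i f g ns nt)).
  rewrite teval_graft; apply: teval_eq_in => j _.
  by case: eqP => // _; rewrite teval_graft.
Qed.

Section Descent.
Variable R : free_op E 3 -> Prop.
Hypothesis R0 : forall x, R x -> forall v, eval v x = 0.
Variables (n : nat) (v : 'I_n -> V).

Definition oeval (x : operad R n) : V := eval v (qrepr x).

Lemma oevalE x : oeval (qclass (@ideal _ _ R n) x) = eval v x.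
Proof. by apply: (qdescE (f := eval_lin v)) => y iy; apply: (eval_ideal R0). Qed.

Fact oeval_linear : linear oeval.
Proof.
move=> a x y; rewrite -[x]qreprK -[y]qreprK -linearP !oevalE.
exact: eval_linear.
Qed.

Lemma oeval_omono t : is_ntree t -> oeval (omono R t) = teval v t.
Proof. by move=> nt; rewrite oevalE eval_mono. Qed.
End Descent.
End Evaluation.

(** * Maps between free operads and commutative associative algebras *)

Section FreeMap.
Variables (k : fieldType) (E1 E2 E' : sig2mod k) (h : E' -> sig2_sum E1 E2).
Hypotheses (hlin : linear h) (hswap : {morph h : e / swap e}).

Fact free_map_linear n : linear (@free_map k E1 E2 E' h n).
Proof.
move=> a x y; rewrite -[x]qreprK -[y]qreprK -linearP !free_mapE //.
exact: linext_linear.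
Qed.

Lemma free_map_mono n (t : btree E' 'I_n) : is_ntree t ->
  free_map h (mono t) = mono (tdecor h t).
Proof.
by move=> nt; rewrite free_mapE //; apply: (linext_tvec (fun t => mono (tdecor h t))).
Qed.
End FreeMap.

Section ComEval.
Variables (k : fieldType).

Lemma is_ntree_tlabel (E : sig2mod k) n (s : 'S_n) (t : btree E 'I_n) :
  is_ntree t -> is_ntree (tlabel s t).
Proof.
move=> nt; apply: ntree_uniq; rewrite leaves_tlabel.
  by rewrite (map_inj_uniq perm_inj) (perm_uniq nt) enum_uniq.
move=> i; rewrite -(permKV s i) map_f // (perm_mem nt) mem_enum //.
Qed.

Lemma is_ntree_tdecor (E E' : sig2mod k) (h : E -> E') n (t : btree E 'I_n) :
  is_ntree (tdecor h t) = is_ntree t.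
Proof. by rewrite /is_ntree leaves_tdecor. Qed.

Section Com.
Variables (V : lmodType k) (op : comE k -> V -> V -> V).
Hypothesis op_e : forall x y, linear (fun e => op e x y).
Hypothesis op_l : forall e y, linear (fun x => op e x y).
Hypothesis op_r : forall e x, linear (op e x).
Hypothesis op_swap : forall e x y, op (swap e) x y = op e y x.
Hypothesis op_assoc : forall x y z, op 1 (op 1 x y) z = op 1 x (op 1 y z).

Lemma eval_comR x : comR x -> forall v, eval op v x = 0.
Proof.
move=> Rx v; pose ev := eval op v.
have evlin : linear ev by apply: eval_linear.
have ev0 : ev 0 = 0 by have := evlin (-1) 0 0; rewrite !scaleN1r !addNr.
rewrite -/(ev x); elim: Rx => {x} [//|a x y [s [_ [-> ->]]] _ IH].
rewrite evlin IH addr0 -scaleN1r addrC linearP /= !relabel_mono ?ntree3l ?ntree3r //.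
have n1 := is_ntree_tlabel s (ntree3l (1 : comE k) 1).
have n2 := is_ntree_tlabel s (ntree3r (1 : comE k) 1).
rewrite evlin /ev !eval_mono //=.
by rewrite op_assoc scaleN1r addNr scaler0.
Qed.
End Com.

Variables (E1 E2 : sig2mod k) (h : comE k -> sig2_sum E1 E2).
Hypotheses (hlin : linear h) (hswap : {morph h : e / swap e}).
Variables (V : lmodType k) (op : sig2_sum E1 E2 -> V -> V -> V).
Hypothesis op_e : forall x y, linear (fun e => op e x y).
Hypothesis op_l : forall e y, linear (fun x => op e x y).
Hypothesis op_r : forall e x, linear (op e x).
Hypothesis op_swap : forall e x y, op (swap e) x y = op e y x.
Hypothesis op_assoc : forall x y z,
  op (h 1) (op (h 1) x y) z = op (h 1) x (op (h 1) y z).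

(** Restricting the operations along [h] gives a commutative associative algebra, to which
    [eval_comR] applies; on trees, its evaluation is that of the image under [free_map]. *)
Lemma eval_free_map_comR x (v : 'I_3 -> V) : comR x -> eval op v (free_map h x) = 0.
Proof.
have ope' u w : linear (fun e => op (h e) u w) by move=> a e e'; rewrite hlin op_e.
have ops' e u w : op (h (swap e)) u w = op (h e) w u.
  exact: etrans (congr1 (fun z => op z u w) (hswap e)) (op_swap _ _ _).
move=> Rx;
rewrite -[RHS](eval_comR ope' (fun e => op_l (h e)) (fun e => op_r (h e)) ops'
  op_assoc Rx v).
pose F0 := eval op v \o @free_map k E1 E2 _ h 3.
have F0lin : linear F0 by move=> a u w; rewrite /F0 /= free_map_linear // eval_linear.
pose F := lin_of F0lin.
pose G0 := eval (fun e => op (h e)) v.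
have G0lin : linear G0 by apply: eval_linear.
pose G := lin_of G0lin.
apply: (free_lin_eq (F := F) (G := G)) => t nt /=.
rewrite /F0 /G0 /= free_map_mono // !eval_mono ?is_ntree_tdecor //.
by elim: t {nt} => //= e l -> r ->.
Qed.
End ComEval.
(** * The operad Com and the composite product Com o Com *)

Section ComOperad.
Variable k : fieldType.
Local Notation com n := (operad (@comR k) n).

Lemma graft_leaf (E L : Type) (t : btree E L) : graft Leaf t = t.
Proof. by elim: t => //= e l -> r ->. Qed.

Lemma relabel1 (E : sig2mod k) n (x : free_op E n) : relabel (1%g : 'S_n) x = x.
Proof.
apply: (free_lin_eq (F := relabel (1%g : 'S_n)) (G := idfun)) => t nt /=.
rewrite relabel_mono //; congr mono.
by rewrite /tlabel (graft_ext (g := Leaf)) ?graft_leaf // => i; rewrite perm1.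
Qed.

Lemma comR_assoc : comR
  (mono (Node (1 : comE k) (Node (1 : comE k) (Leaf leaf0) (Leaf leaf1)) (Leaf leaf2))
   - mono (Node (1 : comE k) (Leaf leaf0) (Node (1 : comE k) (Leaf leaf1) (Leaf leaf2)))).
Proof.
apply: lspan_gen; exists 1%g; eexists; split; first by [].
by rewrite relabel1.
Qed.

Definition com_op (e : comE k) (x y : k^o) : k^o := (e : k) * x * y.

Fact com_op_e x y : linear (fun e => com_op e x y).
Proof. by move=> a e e'; rewrite /com_op /= !mulrDl -!mulrA. Qed.
Fact com_op_l e y : linear (fun x => com_op e x y).
Proof. by move=> a x x'; rewrite /com_op /= mulrDr mulrDl mulrCA -!mulrA. Qed.
Fact com_op_r e x : linear (com_op e x).
Proof. by move=> a y y'; rewrite /com_op /= mulrDr mulrCA. Qed.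
Fact com_op_swap e x y : com_op (swap e) x y = com_op e y x.
Proof. by rewrite /com_op /= mulrAC. Qed.
Fact com_op_assoc x y z : com_op 1 (com_op 1 x y) z = com_op 1 x (com_op 1 y z).
Proof. by rewrite /com_op !mul1r mulrA. Qed.

Let com_eval0 := eval_comR com_op_e com_op_l com_op_r com_op_swap com_op_assoc.

(** Evaluation in the base field with all inputs equal to 1; for n > 0 this is the coordinate on the
    line Com(n). *)
Definition ceps n (x : com n) : k := oeval com_op (fun=> 1) x.

Lemma ceps_linear n (a : k) (x y : com n) : ceps (a *: x + y) = a * ceps x + ceps y.
Proof.
exact: (oeval_linear com_op_e com_op_l com_op_r com_op_swap com_eval0 (fun=> 1) a x y).
Qed.

Lemma ceps_omono n (t : btree (comE k) 'I_n) : is_ntree t ->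
  ceps (omono (@comR k) t) = tcoef (t : btree k 'I_n).
Proof.
move=> nt; rewrite /ceps (oeval_omono com_op_e com_op_l com_op_r com_op_swap com_eval0) //.
by elim: t {nt} => //= e l -> r ->.
Qed.

Lemma operad0_eq0 (x : com 0) : x = 0.
Proof. by rewrite -[x]qreprK [qrepr x]free0_eq0 raddf0. Qed.

(** The generator of the one-dimensional space [Com(n)] for [n > 0]; it is zero
    for [n = 0]. *)
Definition com_gen n : com n :=
  if pselect (exists t : btree unit 'I_n, perm_eq (leaves t) (enum 'I_n)) is left h
  then omono (@comR k) (tdecor (fun=> (1 : comE k)) (projT1 (cid h))) else 0.

Lemma com_comm : swap (1 : comE k) = 1. Proof. by []. Qed.

Lemma tdecor_id (E L : Type) (t : btree E L) : tdecor id t = t.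
Proof. by elim: t => //= e l -> r ->. Qed.

Lemma omono_com n (t : btree (comE k) 'I_n) : is_ntree t ->
  omono (@comR k) t = tcoef (t : btree k 'I_n) *: com_gen n.
Proof.
move=> nt.
have /= := @tscal_graft k (comE k) (@comR k) n _ Leaf Leaf (fun=> 1) id 1 t _ _ Hole.
rewrite graft_leaf tdecor_id big1 // mulr1 => -> //; last first.
- by move=> x K; rewrite scale1r.
- by move=> a; rewrite /GRing.scale /= mulr1.
congr (_ *: _); rewrite /com_gen; case: pselect => [h|[]]; last first.
  by exists (shape t); rewrite leaves_tdecor.
case: (cid h) => S /= pS; rewrite /cmb graft_leaf.
have := cmb_perm com_comm (ideal_gen comR_assoc) Leaf (t := shape t) (t' := S) _ Hole.
by rewrite /= /cmb !graft_leaf; apply; rewrite leaves_tdecor (permPl nt) perm_sym.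
Qed.

(** Every tree monomial is its coefficient [tcoef] times the generator, and [ceps] reads this
    coefficient. In arity 0 both sides are 0. *)
Lemma com_omono_span n (x : com n) : x = ceps x *: com_gen n.
Proof.
pose F0 (y : free_op (comE k) n) := (qclass (@ideal _ _ (@comR k) n) y : com n).
pose G0 (y : free_op (comE k) n) := ceps (F0 y) *: com_gen n.
have G0lin : linear G0.
  by move=> a u v; rewrite /G0 /F0 linearP ceps_linear scalerDl scalerA.
pose G := lin_of G0lin.
rewrite -[x]qreprK; apply: (free_lin_eq (F := qclass _) (G := G)) => t nt /=.
by rewrite /G0 /F0 -/(omono _ t) ceps_omono // -omono_com.
Qed.

Fixpoint left_comb n : btree unit 'I_n.+1 :=
  if n is n'.+1 return btree unit 'I_n.+1
  then Node tt (tlabel (widen_ord (leqnSn n'.+1)) (left_comb n')) (Leaf ord_max)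
  else Leaf ord0.

Lemma left_comb_ntree n : perm_eq (leaves (left_comb n)) (enum 'I_n.+1).
Proof.
elim: n => [|n IH] /=; first by rewrite enum_ordSl enum_ord0.
rewrite leaves_tlabel enum_ordSr cats1 perm_rcons perm_sym perm_rcons perm_cons perm_sym.
exact: perm_map.
Qed.

Lemma tcoef_one X (t : btree unit X) : tcoef (tdecor (fun=> (1 : k)) t) = 1.
Proof. by elim: t => //= _ l -> r ->; rewrite !mulr1. Qed.

Lemma com_genE n (t : btree unit 'I_n) : perm_eq (leaves t) (enum 'I_n) ->
  com_gen n = omono (@comR k) (tdecor (fun=> (1 : comE k)) t).
Proof.
move=> nt; rewrite omono_com; first by rewrite [tcoef _]tcoef_one scale1r.
by rewrite /is_ntree leaves_tdecor.
Qed.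

Lemma ceps_gen n : (0 < n)%N -> ceps (com_gen n) = 1.
Proof.
case: n => // n _; have nt := left_comb_ntree n.
rewrite (com_genE nt) ceps_omono ?[tcoef _]tcoef_one //.
by rewrite /is_ntree leaves_tdecor.
Qed.

Lemma oact_ceps n (s : 'S_n) (x : com n) : ceps (oact s x) = ceps x.
Proof.
pose F0 (y : free_op (comE k) n) : k^o := ceps (oact s (qclass (@ideal _ _ (@comR k) n) y : com n)).
pose G0 (y : free_op (comE k) n) : k^o := ceps (qclass (@ideal _ _ (@comR k) n) y : com n).
have G0lin : linear G0 by move=> a u v; rewrite /G0 linearP ceps_linear.
have F0lin : linear F0.
  by move=> a u v; rewrite /F0 !oactE linearP linearP ceps_linear.
pose F := lin_of F0lin.
pose G := lin_of G0lin.
rewrite -[x]qreprK; apply: (free_lin_eq (F := F) (G := G)) => t nt /=.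
rewrite /F0 /G0 oactE relabel_mono // -/(omono _ _) -/(omono _ _) !ceps_omono ?is_ntree_tlabel //.
by elim: t {nt} => //= e l -> r ->.
Qed.

Lemma oact_gen n (s : 'S_n) : oact s (com_gen n) = com_gen n.
Proof.
case: n s => [|n] s; first by rewrite [LHS]operad0_eq0 [RHS]operad0_eq0.
by rewrite [LHS]com_omono_span oact_ceps ceps_gen // scale1r.
Qed.
End ComOperad.

(** * Coordinates on Com o Com indexed by set partitions *)

Section ComCom.
Variable k : fieldType.
Local Notation com := (operad (@comR k)).
Local Notation act := (@oact k (comE k) (@comR k)).
Variable n : nat.
Local Notation cprod := (comp_prod act act n).

Definition bij_label l (m : 'I_l -> nat) (f : forall s, 'I_(m s) -> 'I_n) :=
  bijective (fun p : {s : 'I_l & 'I_(m s)} => f _ (tagged p)).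

Definition label_blocks l (m : 'I_l -> nat) (f : forall s, 'I_(m s) -> 'I_n) :
    {set {set 'I_n}} :=
  [set [set f s i | i : 'I_(m s)] | s : 'I_l].

Definition com_class l (mu : com l) (m : 'I_l -> nat) (nu : forall s, com (m s))
    (f : forall s, 'I_(m s) -> 'I_n) (fb : bij_label f) : cprod :=
  @comp_class k com com act act n l mu m nu f fb.

(** The coordinate at the partition [p]. It respects the symmetric relations because [ceps] is
    invariant and the set of blocks sees neither the order of the blocks nor the order inside
    them. *)
Definition chi_gen (p : {set {set 'I_n}}) (g : {classic comp_gen com com n}) : k^o :=
  ceps (comp_top g) * \prod_s ceps (comp_inner (c := g) s) *
  (label_blocks (comp_label (c := g)) == p)%:R.

Definition chi p (x : cprod) : k^o := linext (chi_gen p) (qrepr x).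

Lemma chi_qclass p u : chi p (qclass (@comp_rel k com com act act n) u) = linext (chi_gen p) u.
Proof.
apply: (qdescE (f := linext (chi_gen p))) => _ [].
- move=> l a mu1 mu2 m nu f fb; rewrite linearB linearP /= !linextU /chi_gen /=.
  by rewrite ceps_linear /GRing.scale /=; ring.
- move=> l mu m s a nu nu1 nu2 f fb nus nur; rewrite linearB linearP /= !linextU /chi_gen /=.
  rewrite (bigD1 s) //= nus ceps_linear.
  rewrite (bigD1 s (F := fun r => ceps (nu1 r))) //= (bigD1 s (F := fun r => ceps (nu2 r))) //=.
  have -> : \prod_(r | r != s) ceps (nu1 r) = \prod_(r | r != s) ceps (nu r).
    by apply: eq_bigr => r /nur[-> _].
  have -> : \prod_(r | r != s) ceps (nu2 r) = \prod_(r | r != s) ceps (nu r).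
    by apply: eq_bigr => r /nur[_ ->].
  by rewrite /GRing.scale /=; ring.
- move=> l t mu m nu f fb fb'; rewrite linearB /= !linextU /chi_gen /= oact_ceps.
  rewrite (reindex_inj (@perm_inj _ t)) /=.
  suff -> : label_blocks f = label_blocks (fun s => f (t s)) by rewrite subrr.
  apply/setP => A; apply/imsetP/imsetP => -[s _ ->].
    by exists (t^-1%g s) => //; rewrite permKV.
  by exists (t s).
- move=> l mu m t nu f fb fb'; rewrite linearB /= !linextU /chi_gen /=.
  under eq_bigr do rewrite oact_ceps.
  suff -> : label_blocks f = label_blocks (fun s i => f s (t s i)) by rewrite subrr.
  apply: eq_imset => s; apply/setP => x; apply/imsetP/imsetP => -[i _ ->].
    by exists ((t s)^-1%g i) => //; rewrite permKV.
  by exists (t s i).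
Qed.

Fact chi_linear p : linear (chi p).
Proof.
move=> a x y; rewrite -[x]qreprK -[y]qreprK -linearP !chi_qclass.
exact: linext_linear.
Qed.

HB.instance Definition _ p :=
  GRing.isLinear.Build k cprod k^o *:%R (chi p) (chi_linear p).

Lemma chi_class p l (mu : com l) (m : 'I_l -> nat) (nu : forall s, com (m s))
    (f : forall s, 'I_(m s) -> 'I_n) (fb : bij_label f) :
  chi p (com_class mu nu fb) =
  ceps mu * \prod_s ceps (nu s) * (label_blocks f == p)%:R.
Proof. by rewrite /com_class /comp_class chi_qclass linextU. Qed.

Section Pure.
Variables (l : nat) (m : 'I_l -> nat) (f : forall s, 'I_(m s) -> 'I_n).
Hypothesis fb : bij_label f.

Lemma class_top a (mu1 mu2 : com l) nu :
  com_class (a *: mu1 + mu2) nu fb = a *: com_class mu1 nu fb + com_class mu2 nu fb.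
Proof. by rewrite /com_class /comp_class -linearP; apply/qclass_eq/lspan_gen/comp_rel_top. Qed.

Lemma class_inner (mu : com l) s a (nu nu1 nu2 : forall s, com (m s)) :
    nu s = a *: nu1 s + nu2 s ->
    (forall r, r != s -> nu1 r = nu r /\ nu2 r = nu r) ->
  com_class mu nu fb = a *: com_class mu nu1 fb + com_class mu nu2 fb.
Proof.
move=> h h'; rewrite /com_class /comp_class -linearP; apply/qclass_eq/lspan_gen.
exact: comp_rel_inner h h'.
Qed.

Lemma class_inner0 (mu : com l) s nu : nu s = 0 -> com_class mu nu fb = 0.
Proof.
move=> h; have := @class_inner mu s (-1) nu nu nu.
by rewrite h scaler0 addr0 scaleN1r addNr => ->.
Qed.

Lemma class_top0 nu : com_class (0 : com l) nu fb = 0.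
Proof. by have := class_top (-1) 0 0 nu; rewrite !scaleN1r !addNr. Qed.

Definition pure_class : cprod := com_class (com_gen k l) (fun s => com_gen k (m s)) fb.

(** The inner operations are replaced by generators one position at a time; the list [r] records the
    positions already replaced. *)
Lemma class_pure (mu : com l) nu :
  com_class mu nu fb = (ceps mu * \prod_s ceps (nu s)) *: pure_class.
Proof.
have -> : com_class mu nu fb = ceps mu *: com_class (com_gen k l) nu fb.
  by rewrite {1}[mu]com_omono_span -[ceps mu *: _]addr0 class_top class_top0 addr0.
rewrite -scalerA; congr (_ *: _).
pose nu' (r : seq 'I_l) s := if s \in r then com_gen k (m s) else nu s.
have -> : pure_class = com_class (com_gen k l) (nu' (enum 'I_l)) fb.
  apply: (congr1 (fun nu => com_class (com_gen k l) nu fb)).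
  apply: functional_extensionality_dep => s.
  by rewrite /nu' mem_enum.
rewrite -big_enum /=.
suff H : forall r, uniq r -> com_class (com_gen k l) nu fb =
   (\prod_(s <- r) ceps (nu s)) *: com_class (com_gen k l) (nu' r) fb.
  by rewrite -H ?enum_uniq.
elim=> [_|s r IH /= /andP[sr ur]].
  by rewrite big_nil scale1r; apply: (congr1 (fun nu => com_class (com_gen k l) nu fb)).
rewrite big_cons mulrC -scalerA IH //; congr (_ *: _).
(* The relation splits [nu s] as [a *: nu1 s + nu2 s]; the second family is 0 at [s], so that its
   class vanishes. *)
pose nu0 r' := if r' == s then 0 else nu' r r'.
rewrite (@class_inner _ s (ceps (nu s)) _ (nu' (s :: r)) nu0).
- by rewrite (@class_inner0 _ s nu0) ?addr0 // /nu0 eqxx.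
- rewrite /nu0 eqxx addr0 /nu' (negbTE sr) inE eqxx /=.
  exact: com_omono_span.
- by move=> r' /negbTE r's; rewrite /nu0 /nu' r's inE r's.
Qed.

Lemma label_inj s : injective (f (s := s)).
Proof.
move=> i j e.
exact: (eq_from_Tagged (bij_inj fb (x1 := Tagged (fun s => 'I_(m s)) i)
  (x2 := Tagged (fun s => 'I_(m s)) j) e)).
Qed.

Lemma label_tag s s' (i : 'I_(m s)) (i' : 'I_(m s')) : f i = f i' -> s = s'.
Proof.
move=> e.
exact: (congr1 tag (bij_inj fb (x1 := Tagged (fun s => 'I_(m s)) i)
  (x2 := Tagged (fun s => 'I_(m s)) i') e)).
Qed.

Hypothesis m_gt0 : forall s, (0 < m s)%N.

Lemma label_block_inj : injective (fun s => [set f i | i : 'I_(m s)]).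
Proof.
move=> s s' /setP e.
have := e (f (Ordinal (m_gt0 s))); rewrite imset_f // => /esym/imsetP[i _].
exact: label_tag.
Qed.

Lemma card_label_blocks : #|label_blocks f| = l.
Proof. by rewrite card_imset ?card_ord //; apply: label_block_inj. Qed.

End Pure.

Lemma pure_class_ext l (m : 'I_l -> nat) (f f' : forall s, 'I_(m s) -> 'I_n)
    (fb : bij_label f) (fb' : bij_label f') : f = f' -> pure_class fb = pure_class fb'.
Proof.
by move=> e; subst f'; congr pure_class; apply: Prop_irrelevance.
Qed.

(** The two labellings of each block differ by a permutation of its inputs, absorbed by the inner
    symmetric relation since the generator of Com is invariant. *)
Lemma pure_class_eq l (m m' : 'I_l -> nat) (f : forall s, 'I_(m s) -> 'I_n)
    (f' : forall s, 'I_(m' s) -> 'I_n) (fb : bij_label f) (fb' : bij_label f') :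
    (forall s, [set f s i | i : 'I_(m s)] = [set f' s i | i : 'I_(m' s)]) ->
  pure_class fb = pure_class fb'.
Proof.
move=> e; have mm' : m = m'.
  apply: functional_extensionality_dep => s.
  have := congr1 (fun A : {set 'I_n} => #|A|) (e s).
  by rewrite !card_imset ?card_ord //; apply: label_inj.
subst m'.
have im s i : {j | f s j = f' s i}.
  have : f' s i \in [set f s i | i : 'I_(m s)] by rewrite e imset_f.
  by move/imsetP/cid2 => [j _ ->]; exists j.
pose t0 s i := sval (im s i).
have t0E s i : f s (t0 s i) = f' s i by rewrite /t0; case: (im s i).
have t0inj s : injective (t0 s).
  move=> i j /(congr1 (f s)); rewrite !t0E; exact: label_inj.
pose t s := perm (@t0inj s).
have fE : (fun s i => f s (t s i)) = f'.
  apply: functional_extensionality_dep => s; apply: functional_extensionality_dep => i.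
  by rewrite permE t0E.
have fb2 : bij_label (fun s i => f s (t s i)) by rewrite fE.
have -> : pure_class fb' = pure_class fb2.
  exact/pure_class_ext/esym.
have e2 : (fun s => com_gen k (m s)) = fun s => act (t s) (com_gen k (m s)).
  by apply: functional_extensionality_dep => s; rewrite oact_gen.
rewrite {1}/pure_class e2; apply/qclass_eq/lspan_gen.
exact: comp_rel_sym_inner.
Qed.

(** The positions of the blocks differ by a permutation of the inputs of the top operation, absorbed
    by the top symmetric relation; what remains is a relabelling inside the blocks. *)
Lemma pure_class_uniq l (m : 'I_l -> nat) (f : forall s, 'I_(m s) -> 'I_n)
    l' (m' : 'I_l' -> nat) (f' : forall s, 'I_(m' s) -> 'I_n)
    (fb : bij_label f) (fb' : bij_label f') :
    (forall s, (0 < m s)%N) -> (forall s, (0 < m' s)%N) ->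
  label_blocks f = label_blocks f' -> pure_class fb = pure_class fb'.
Proof.
move=> m0 m0' e.
have ll' : l = l' by rewrite -(card_label_blocks fb m0) e card_label_blocks.
subst l'.
have im s : {r | [set f r i | i : 'I_(m r)] = [set f' s i | i : 'I_(m' s)]}.
  have : [set f' s i | i : 'I_(m' s)] \in label_blocks f by rewrite e imset_f.
  by move/imsetP/cid2 => [r _ ->]; exists r.
pose t0 s := sval (im s).
have t0E s : [set f (t0 s) i | i : 'I_(m (t0 s))] = [set f' s i | i : 'I_(m' s)].
  by rewrite /t0; case: (im s).
have t0inj : injective t0.
  move=> s s' h; apply: (label_block_inj fb' m0').
  by rewrite /= -t0E h t0E.
pose t := perm t0inj.
have fb2 : bij_label (fun s => f (t s)).
  case: fb => g gK Kg.
  pose T s := 'I_(m (t s)).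
  have inj : injective (fun p : {s : 'I_l & T s} => f (t (tag p)) (tagged p)).
    case=> s i [s' i'] /= h.
    have ts : t s = t s' by apply: (label_tag (Bijective gK Kg)) h.
    have ss := perm_inj ts; subst s'.
    by rewrite (label_inj (Bijective gK Kg) h).
  have sur x : {p : {s : 'I_l & T s} | f (t (tag p)) (tagged p) = x}.
    have := Kg x; case: (g x) => r /= i h.
    have [u ur] : {u | t u = r} by exists (t^-1%g r); rewrite permKV.
    by subst r; exists (Tagged T i).
  exists (fun x => sval (sur x)) => [p|x]; last by case: (sur x).
  by apply: inj; case: (sur _).
transitivity (pure_class fb2); last first.
  by apply: pure_class_eq => s; rewrite permE t0E.
rewrite {1}/pure_class -((oact_gen k t)).
apply/qclass_eq/lspan_gen; exact: comp_rel_sym_top.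
Qed.

End ComCom.

(** * The basis of Com o Com and two-level trees *)

Section PartGen.
Variable k : fieldType.
Local Notation com := (operad (@comR k)).
Local Notation act := (@oact k (comE k) (@comR k)).

Lemma malg_lin_eq (G : choiceType) (W : lmodType k) (F F' : {linear {malg k[G]} -> W}) :
  (forall g, F << g >> = F' << g >>) -> F =1 F'.
Proof.
move=> FF' u; rewrite [u]monalgE !linear_sum; apply: eq_bigr => g _ /=.
have -> : << (mcoeff g u) *g g >> = mcoeff g u *: << g >> :> {malg k[G]}.
  by apply/malgP => g'; rewrite mcoeffZ !mcoeffU mulr_natr.
by rewrite !linearZ /= FF'.
Qed.

Variable n : nat.
Local Notation cprod := (comp_prod act act n).

(** Blocks are required to be nonempty: a class with an inner operation of arity 0 vanishes because
    Com(0) = 0. *)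
Definition part_gen (p : {set {set 'I_n}}) : cprod :=
  if pselect (exists g : comp_gen com com n,
      (forall s, 0 < @comp_arities _ _ _ _ g s)%N /\
      label_blocks (comp_label (c := g)) = p) is left h
  then pure_class k (@comp_label_bij _ _ _ _ (projT1 (cid h))) else 0.

Lemma pure_part_gen l (m : 'I_l -> nat) (f : forall s, 'I_(m s) -> 'I_n)
    (fb : bij_label f) : (forall s, (0 < m s)%N) ->
  pure_class k fb = part_gen (label_blocks f).
Proof.
move=> m0; rewrite /part_gen; case: pselect => [h|[]]; last first.
  by exists (CompGen (com_gen k l) (fun s => com_gen k (m s)) fb).
by case: (cid h) => g /= [g0 e]; apply: pure_class_uniq.
Qed.

(** A class with an empty block is 0; any other is a multiple of the class of its partition, and
    [chi] reads the multiple. *)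
Lemma part_gen_span (x : cprod) : x = \sum_p chi p x *: part_gen p.
Proof.
pose F0 (u : comp_free com com n) : cprod := qclass _ u.
pose G0 (u : comp_free com com n) : cprod := \sum_p chi p (F0 u) *: part_gen p.
have G0lin : linear G0.
  move=> a u v; rewrite /G0 /F0 scaler_sumr -big_split; apply: eq_bigr => p _.
  by rewrite !linearP /= scalerDl scalerA.
rewrite -[x]qreprK.
apply: (malg_lin_eq (F := qclass _) (F' := lin_of G0lin)) => -[l mu m nu f fb] /=.
rewrite /G0 /F0 -[qclass _ _]/(com_class mu nu fb).
have [[s ms]|m0] := pselect (exists s, m s = 0%N).
  have nu0 : nu s = 0.
    by move: (nu s); rewrite ms => y; apply: operad0_eq0.
  by rewrite (class_inner0 fb mu nu0) big1 // => p _; rewrite linear0 scale0r.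
rewrite (bigD1 (label_blocks f)) //= chi_class eqxx mulr1 [X in _ + X]big1 => [|p pf]; last first.
  by rewrite chi_class eq_sym (negbTE pf) mulr0 scale0r.
rewrite addr0 class_pure; congr (_ *: _); apply: pure_part_gen => s.
by rewrite lt0n; apply/eqP => ms; apply: m0; exists s.
Qed.

Lemma chi_pure p l (m : 'I_l -> nat) (f : forall s, 'I_(m s) -> 'I_n)
    (fb : bij_label f) : (0 < l)%N -> (forall s, (0 < m s)%N) ->
  chi p (pure_class k fb) = (label_blocks f == p)%:R.
Proof.
move=> l0 m0; rewrite chi_class ceps_gen // big1 ?mulr1 ?mul1r // => s _.
exact: ceps_gen.
Qed.

Section Forest.
Variables (l : nat) (m : 'I_l -> nat) (f : forall s, 'I_(m s) -> 'I_n).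
Variables (T : btree unit 'I_l) (U : forall s, btree unit 'I_(m s)).
Hypotheses (fb : bij_label f) (nT : perm_eq (leaves T) (enum 'I_l)).
Hypothesis nU : forall s, perm_eq (leaves (U s)) (enum 'I_(m s)).

Definition forest_of : btree unit (btree unit 'I_n) :=
  tlabel (fun s => tlabel (f (s := s)) (U s)) T.

Lemma forest_ofP : is_nforest forest_of.
Proof.
have lE : labels forest_of = [seq f i | s <- leaves T, i <- leaves (U s)].
  rewrite /labels leaves_tlabel -map_comp; congr flatten; apply: eq_map => s /=.
  by rewrite leaves_tlabel.
rewrite /is_nforest lE; apply: uniq_perm; rewrite ?enum_uniq //.
  apply: allpairs_uniq_dep => [|s _|].
  - by rewrite (perm_uniq nT) enum_uniq.
  - by rewrite (perm_uniq (nU s)) enum_uniq.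
  - by move=> x y _ _; apply: (bij_inj fb).
move=> x; rewrite mem_enum; case: fb => g _ Kg; apply/allpairsPdep.
exists (tag (g x)), (tagged (g x)); rewrite (perm_mem nT) (perm_mem (nU _)) !mem_enum.
by split=> //; rewrite (Kg x).
Qed.

Lemma parts_forest_of : parts forest_of = label_blocks f.
Proof.
have bE s : block (tlabel (f (s := s)) (U s)) = [set f i | i : 'I_(m s)].
  apply/setP => x; rewrite inE leaves_tlabel; apply/mapP/imsetP => -[i _ ->].
    by exists i.
  by exists i; rewrite // (perm_mem (nU s)) mem_enum.
apply/setP => A; rewrite inE leaves_tlabel -map_comp.
apply/mapP/imsetP => -[s _ ->]; exists s; rewrite //= ?bE //.
by rewrite (perm_mem nT) mem_enum.
Qed.
End Forest.

Lemma uniq_flatten_nth (X : eqType) (ss : seq (seq X)) i j x :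
  uniq (flatten ss) -> x \in nth [::] ss i -> x \in nth [::] ss j -> i = j.
Proof.
elim: ss i j => [|s ss IH] [|i] [|j] //=; rewrite ?nth_nil // cat_uniq => /and3P[us h uss].
- move=> xs xj; case/negP: h; apply/hasP; exists x => //.
  apply/flattenP; exists (nth [::] ss j) => //; apply: mem_nth.
  by rewrite ltnNge; apply/negP => hj; rewrite nth_default in xj.
- move=> xj xs; case/negP: h; apply/hasP; exists x => //.
  apply/flattenP; exists (nth [::] ss i) => //; apply: mem_nth.
  by rewrite ltnNge; apply/negP => hj; rewrite nth_default in xj.
- by move=> hi hj; rewrite (IH i j).
Qed.

(** The blocks are the leaves of the outer shape, in order, and the inputs of a block are the
    positions in its list of leaves. Bijectivity is disjointness and covering. *)
Lemma forest_label (t : btree unit (btree unit 'I_n)) : is_nforest t ->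
  exists l (m : 'I_l -> nat) (f : forall s, 'I_(m s) -> 'I_n),
    [/\ (0 < l)%N, forall s, (0 < m s)%N, bij_label f & label_blocks f = parts t].
Proof.
move=> nt; pose L := leaves t; pose tr (s : 'I_(size L)) := tnth (in_tuple L) s.
pose m s := size (leaves (tr s)).
pose f s (i : 'I_(m s)) : 'I_n := tnth (in_tuple (leaves (tr s))) i.
have trL s : tr s \in L by apply: mem_tnth.
have fin s (i : 'I_(m s)) : f s i \in leaves (tr s) by apply: mem_tnth.
exists (size L), m, f; split.
- by rewrite /L lt0n size_eq0; apply/eqP/leaves_neq0.
- by move=> s; rewrite lt0n size_eq0; apply/eqP/leaves_neq0.
- have ut := nforest_uniq nt.
  have trE s : leaves (tr s) = nth [::] [seq leaves u | u <- L] s.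
    by rewrite /tr (tnth_nth (tr s)) /= (nth_map (tr s)).
  have inj : injective (fun p : {s : 'I_(size L) & 'I_(m s)} => f _ (tagged p)).
    case=> s i [s' i'] /= h.
    have ss : s = s'.
      apply: val_inj; apply: (uniq_flatten_nth (x := f s i) ut).
        by rewrite -trE.
      by rewrite h -trE.
    subst s'; congr Tagged; apply: val_inj; apply/eqP.
    have us : uniq (leaves (tr s)) := uniq_flatten_in ut (trL s).
    move: h; rewrite /f !(tnth_nth (f s i)) /= => /eqP.
    by rewrite nth_uniq.
  have sur x : {p : {s : 'I_(size L) & 'I_(m s)} | f _ (tagged p) = x}.
    apply: cid; have : x \in labels t by rewrite (perm_mem nt) mem_enum.
    move/flattenP => [_ /mapP[u uL ->] xu].
    have [s us] : exists s, u = tr s by apply/tnthP.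
    subst u; have [i xi] : exists i, x = f s i by apply/tnthP; apply: xu.
    by exists (Tagged (fun s => 'I_(m s)) i); rewrite xi.
  exists (fun x => sval (sur x)) => [p|x]; last by case: (sur x).
  by apply: inj; case: (sur _).
- have bE s : [set f s i | i : 'I_(m s)] = block (tr s).
    apply/setP => x; rewrite inE; apply/imsetP/idP => [[i _ ->] //|xs].
    by have [i ->] : exists i, x = f s i by [apply/tnthP]; exists i.
  apply/setP => A; rewrite inE; apply/imsetP/mapP => [[s _ ->]|[u uL ->]].
    by exists (tr s).
  by have [s ->] : exists s, u = tr s by [apply/tnthP]; exists s.
Qed.

Lemma left_combP l : (0 < l)%N -> exists T : btree unit 'I_l, perm_eq (leaves T) (enum 'I_l).
Proof. by case: l => // l _; exists (left_comb l); apply: left_comb_ntree. Qed.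

(** Together with [part_gen_span], this is the duality between the classes of partitions and the
    coordinates [chi]. *)
Lemma chi_part_gen p t : is_nforest t -> chi p (part_gen (parts t)) = (parts t == p)%:R.
Proof.
move=> /forest_label[l [m [f [l0 m0 fb <-]]]].
by rewrite -(pure_part_gen fb) // chi_pure.
Qed.

End PartGen.

(** * The operad P defined by D *)

Section DistCom.
Variable k : fieldType.
Variable D : {linear free3_12 (comE k) (comE k) -> free3_21 (comE k) (comE k)}.
Local Notation E := (sig2_sum (comE k) (comE k)).
Local Notation R := (dist_rel (@comR k) (@comR k) D).

Definition opa : E := sig2_inl _ (1 : comE k).
Definition opb : E := sig2_inr _ (1 : comE k).

Lemma opa_comm : swap opa = opa. Proof. by []. Qed.
Lemma opb_comm : swap opb = opb. Proof. by []. Qed.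

Lemma free_map0 (h : comE k -> E) n : linear h -> {morph h : e / swap e} ->
  free_map h (0 : free_op (comE k) n) = 0.
Proof.
move=> hlin hs; have := free_map_linear hlin hs (-1) (0 : free_op (comE k) n) 0.
by rewrite !scaleN1r !addNr.
Qed.

Lemma comR0 : comR (0 : free_op (comE k) 3). Proof. exact: lspan0. Qed.

Lemma free_map_assoc (h : comE k -> E) : linear h -> {morph h : e / swap e} ->
  free_map h
    (mono (Node (1 : comE k) (Node (1 : comE k) (Leaf leaf0) (Leaf leaf1)) (Leaf leaf2))
   - mono (Node (1 : comE k) (Leaf leaf0) (Node (1 : comE k) (Leaf leaf1) (Leaf leaf2))))
  = mono (Node (h 1) (Node (h 1) (Leaf leaf0) (Leaf leaf1)) (Leaf leaf2))
   - mono (Node (h 1) (Leaf leaf0) (Node (h 1) (Leaf leaf1) (Leaf leaf2))).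
Proof.
move=> hlin hs; have hl := free_map_linear hlin hs (n := 3).
rewrite -scaleN1r addrC hl !free_map_mono ?ntree3l ?ntree3r //=.
by rewrite scaleN1r addrC.
Qed.

Lemma dist_ideal_l r : comR r -> ideal R (free_map (@sig2_inl k (comE k) (comE k)) r).
Proof.
move=> Rr; apply: ideal_gen; exists r, 0, 0; split; [by [] | exact: comR0 |].
rewrite (@free_map0 (@sig2_inr _ _ _)); [|exact: sig2_inr_linear|exact: sig2_inr_swap].
by rewrite !linear0 !addr0.
Qed.

Lemma dist_ideal_r r : comR r -> ideal R (free_map (@sig2_inr k (comE k) (comE k)) r).
Proof.
move=> Rr; apply: ideal_gen; exists 0, 0, r; split; [exact: comR0 | by [] |].
rewrite (@free_map0 (@sig2_inl _ _ _)); [|exact: sig2_inl_linear|exact: sig2_inl_swap].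
by rewrite !linear0 !add0r.
Qed.

Lemma dist_ideal_D x : ideal R (val x - val (D x)).
Proof.
apply: ideal_gen; exists 0, x, 0; split; try exact: comR0.
rewrite (@free_map0 (@sig2_inl _ _ _)); [|exact: sig2_inl_linear|exact: sig2_inl_swap].
rewrite (@free_map0 (@sig2_inr _ _ _)); [|exact: sig2_inr_linear|exact: sig2_inr_swap].
by rewrite add0r addr0.
Qed.

Lemma opa_assoc : ideal R
  (mono (Node opa (Node opa (Leaf leaf0) (Leaf leaf1)) (Leaf leaf2))
   - mono (Node opa (Leaf leaf0) (Node opa (Leaf leaf1) (Leaf leaf2)))).
Proof.
have := dist_ideal_l (comR_assoc k).
by rewrite free_map_assoc; [|exact: sig2_inl_linear|exact: sig2_inl_swap].
Qed.

Lemma opb_assoc : ideal R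
  (mono (Node opb (Node opb (Leaf leaf0) (Leaf leaf1)) (Leaf leaf2))
   - mono (Node opb (Leaf leaf0) (Node opb (Leaf leaf1) (Leaf leaf2)))).
Proof.
have := dist_ideal_r (comR_assoc k).
by rewrite free_map_assoc; [|exact: sig2_inr_linear|exact: sig2_inr_swap].
Qed.

Variable n : nat.
Local Notation wcls := (part_class R (n := n) opa opb).

Lemma omono_flat t : is_nforest t -> omono R (flat opa opb t) = wcls (parts t).
Proof.
exact: (part_classE opa_comm opb_comm opa_assoc opb_assoc).
Qed.

Lemma tlabel_cmb (h : comE k -> E) L (g : L -> 'I_n) (t : btree unit L) :
  tlabel g (tdecor h (tdecor (fun=> (1 : comE k)) t)) = cmb (h 1) Leaf (tlabel g t).
Proof. by rewrite /cmb /tlabel; elim: t => //= u l -> r ->. Qed.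

(** [is_xi] prescribes [xi] on tree monomials, so the generators of Com are first written as
    monomials of left combs. Their composite is a two-level tree with the right blocks, which
    coherence identifies with the given one. *)
Lemma xi_part_gen (xi : comp21 (@comR k) (@comR k) n -> operad R n) t :
  is_xi xi -> is_nforest t -> xi (part_gen k (parts t)) = omono R (flat opa opb t).
Proof.
move=> hxi nt; rewrite (omono_flat nt).
have [l [m [f [l0 m0 fb <-]]]] := forest_label nt.
have [T nT] := left_combP l0.
have /cid[U nU] : exists U : forall s, btree unit 'I_(m s),
    forall s, perm_eq (leaves (U s)) (enum 'I_(m s)).
  exists (fun s => sval (cid (left_combP (m0 s)))) => s.
  exact: (svalP (cid (left_combP (m0 s)))).
rewrite -(pure_part_gen k fb m0) /pure_class (com_genE k nT).
have -> : (fun s => com_gen k (m s)) =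
    fun s => omono (@comR k) (tdecor (fun=> (1 : comE k)) (U s)).
  by apply: functional_extensionality_dep => s; rewrite (com_genE k (nU s)).
rewrite hxi.
- rewrite -(parts_forest_of f nT nU) -omono_flat; last exact: forest_ofP.
  congr (omono _ _); rewrite /flat /cmb /forest_of.
  elim: (T) => [s|[] L IHL r IHr] /=; last by rewrite IHL IHr.
  exact: tlabel_cmb.
- by rewrite /is_ntree leaves_tdecor.
- by move=> s; rewrite /is_ntree leaves_tdecor.
Qed.
End DistCom.
(** * Triviality of distributive laws *)

Section SubspaceVal.
Variables (k : fieldType) (V : lmodType k) (S : V -> Prop).

Lemma subspace_val0 : val (0 : subspace S) = 0.
Proof. exact: linear0. Qed.

Lemma subspace_val_lin c (x y : subspace S) : val (c *: x + y) = c *: val x + val y.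
Proof. exact: linearP. Qed.

Lemma subspace_eq (x y : subspace S) : val x = val y -> x = y.
Proof. exact: val_inj. Qed.
End SubspaceVal.

(** * The arity 3 components F(E)(3)_12 and F(E)(3)_21 *)

Section Level3.
Variable k : fieldType.
Local Notation E := (sig2_sum (comE k) (comE k)).
Local Notation inc1 := (@sig2_inl k (comE k) (comE k)).
Local Notation inc2 := (@sig2_inr k (comE k) (comE k)).
Local Notation a := (opa k).
Local Notation b := (opb k).

Lemma sig2_inlE (c : comE k) : inc1 c = (c : k) *: a.
Proof. by rewrite /opa /sig2_inl -[RHS]/(_, _) /= scaler0 [_ *: _]mulr1. Qed.

Lemma sig2_inrE (c : comE k) : inc2 c = (c : k) *: b.
Proof. by rewrite /opb /sig2_inr -[RHS]/(_, _) /= scaler0 [_ *: _]mulr1. Qed.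

Lemma mono_scale2 (e e' : E) (c c' : k) n (i j l : 'I_n) :
  mono (Node (c *: e) (Leaf i) (Node (c' *: e') (Leaf j) (Leaf l))) =
  (c * c') *: mono (Node e (Leaf i) (Node e' (Leaf j) (Leaf l))).
Proof.
rewrite (mono_plug_scale Hole) /= -scalerA; congr (_ *: _).
exact: (mono_plug_scale (CtxR e (Leaf i) Hole)).
Qed.

Lemma mono_comm (e : E) n (S T : btree E 'I_n) :
  mono (Node e S T) = mono (Node e T S).
Proof. by apply/mono_swap; rewrite -{1}[e]swapK; case: e => *; constructor. Qed.

Lemma ntree3 (e e' : E) (s : 'S_3) i j l : uniq [:: i; j; l] ->
  is_ntree (Node e (Leaf (s i)) (Node e' (Leaf (s j)) (Leaf (s l)))).
Proof.
move=> u; rewrite -[Node _ _ _]/(tlabel s (Node e (Leaf i) (Node e' (Leaf j) (Leaf l)))).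
apply: is_ntree_tlabel; apply: ntree_uniq => //= x.
by case: i j l x u => [[|[|[]]]] // ? [[|[|[]]]] // ? [[|[|[]]]] // ? [[|[|[]]]] //.
Qed.

Definition two (e e' : E) (i j l : 'I_3) : free_op E 3 :=
  mono (Node e (Leaf i) (Node e' (Leaf j) (Leaf l))).

Lemma two_comm e e' i j l : two e e' i j l = two e e' i l j.
Proof.
apply/mono_swap/swap_right; rewrite -{1}[e']swapK.
by case: e' => *; constructor.
Qed.

(** Up to scalars, all the compositions are relabellings of [e(0, e'(1, 2))]. *)
Lemma orbits3_two (A B : E) (h g : comE k -> E) x :
    (forall c : comE k, h c = (c : k) *: A) -> (forall c : comE k, g c = (c : k) *: B) ->
  orbits3 (two_level h g) x ->
  exists (c : k) (s : 'S_3), x = c *: two A B (s leaf0) (s leaf1) (s leaf2).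
Proof.
move=> hA gB [s [y [[mu nu|mu nu] ->]]].
  exists (mu * nu), s.
  by rewrite relabel_mono ?ntree3r // hA gB mono_scale2.
(* Commutativity turns e(e'(0, 1), 2) into e(2, e'(0, 1)); adding 2 modulo 3 sends the labels 0, 1,
   2 to 2, 0, 1. *)
pose r : 'S_3 := perm (addrI (leaf2 : 'I_3)).
exists (mu * nu), (r * s)%g; rewrite relabel_mono ?ntree3l // mono_comm hA gB mono_scale2.
congr (_ *: _); rewrite /two !permM !permE /=.
have -> : leaf2 + leaf0 = leaf2 by apply: val_inj.
have -> : leaf2 + leaf1 = leaf0 by apply: val_inj.
by have -> : leaf2 + leaf2 = leaf1 by apply: val_inj.
Qed.

Lemma scale_comb3 (V : lmodType k) (x y z : V) c d d0 d1 d2 c0 c1 c2 :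
  c *: (d *: (d0 *: x + d1 *: y + d2 *: z)) + (c0 *: x + c1 *: y + c2 *: z) =
  (c * d * d0 + c0) *: x + (c * d * d1 + c1) *: y + (c * d * d2 + c2) *: z.
Proof.
rewrite scalerA !scalerDr !scalerA !scalerDl.
by rewrite [LHS]addrACA; congr (_ + _); rewrite addrACA.
Qed.

(** As b(i, a(j, l)) is symmetric in [j] and [l], only the outer label matters, which leaves three
    monomials. *)
Lemma span21 x : lspan (orbits3 (two_level inc2 inc1)) x ->
  exists c0 c1 c2 : k, x = c0 *: two b a leaf0 leaf1 leaf2 +
    c1 *: two b a leaf1 leaf0 leaf2 + c2 *: two b a leaf2 leaf0 leaf1.
Proof.
elim=> {x} [|c x y /(orbits3_two sig2_inrE sig2_inlE)[d [s ->]] _ [c0 [c1 [c2 ->]]]].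
  by exists 0, 0, 0; rewrite !scale0r !addr0.
have us : uniq [:: s leaf0; s leaf1; s leaf2].
  by rewrite -[_ :: _]/(map s [:: leaf0; leaf1; leaf2]) (map_inj_uniq perm_inj).
have H i j l : uniq [:: i; j; l] -> exists c0 c1 c2 : k,
    two b a i j l = c0 *: two b a leaf0 leaf1 leaf2 +
    c1 *: two b a leaf1 leaf0 leaf2 + c2 *: two b a leaf2 leaf0 leaf1.
  have o : forall q : 'I_3, [\/ q = leaf0, q = leaf1 | q = leaf2].
    by case=> [[|[|[|]]] //= h]; [constructor 1|constructor 2|constructor 3]; apply: val_inj.
  case: (o i) => ->; case: (o j) => ->; case: (o l) => -> // _.
  - by exists 1, 0, 0; rewrite !scale0r !addr0 scale1r.
  - by exists 1, 0, 0; rewrite !scale0r !addr0 scale1r two_comm.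
  - by exists 0, 1, 0; rewrite !scale0r !addr0 add0r scale1r.
  - by exists 0, 1, 0; rewrite !scale0r !addr0 add0r scale1r two_comm.
  - by exists 0, 0, 1; rewrite !scale0r !add0r scale1r.
  - by exists 0, 0, 1; rewrite !scale0r !add0r scale1r two_comm.
have [d0 [d1 [d2 ->]]] := H _ _ _ us.
exists (c * d * d0 + c0), (c * d * d1 + c1), (c * d * d2 + c2).
exact: scale_comb3.
Qed.

Variable D : {linear free3_12 (comE k) (comE k) -> free3_21 (comE k) (comE k)}.

Lemma two_level_ab : two_level inc1 inc2 (two a b leaf0 leaf1 leaf2).
Proof. exact: two_level_r. Qed.

Lemma two_span (s : 'S_3) : relabel s (two a b leaf0 leaf1 leaf2) \in
  in_span (orbits3 (two_level inc1 inc2)).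
Proof.
apply/in_spanP/lspan_gen; exists s, (two a b leaf0 leaf1 leaf2); split=> //.
exact: two_level_ab.
Qed.

Definition base12 (s : 'S_3) : free3_12 (comE k) (comE k) := Subspace (two_span s).

(** F(E)(3)_12 is spanned by the relabellings of a(0, b(1, 2)), so by equivariance the value on this
    element decides. *)
Lemma D_eq0 : equivariant3 D -> D (base12 1%g) = 0 -> forall x, D x = 0.
Proof.
move=> Deq D0.
have Ds s : D (base12 s) = 0.
  apply: subspace_eq; rewrite subspace_val0.
  have -> : val (D (base12 s)) = relabel s (val (D (base12 1%g))).
    by apply: Deq; rewrite /= relabel1.
  by rewrite D0 subspace_val0 linear0.
suff H v : lspan (orbits3 (two_level inc1 inc2)) v ->
    forall x : free3_12 (comE k) (comE k), val x = v -> D x = 0.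
  by move=> x; apply: (H (val x)) => //; apply/in_spanP; apply: valP x.
elim=> {v} [x x0|c u v Su Sv IH x xE].
  have -> : x = 0 by apply: subspace_eq; rewrite x0 subspace_val0.
  exact: linear0.
have [d [s uE]] := orbits3_two sig2_inlE sig2_inrE Su.
pose y : free3_12 (comE k) (comE k) := Subspace (introT (in_spanP _ _) Sv).
have bE : val (base12 s) = two a b (s leaf0) (s leaf1) (s leaf2).
  by rewrite /= /two relabel_mono ?ntree3r.
have yE : val y = v by [].
have -> : x = (c * d) *: base12 s + y.
  apply: subspace_eq.
  have e := subspace_val_lin (c * d) (base12 s) y.
  rewrite bE yE in e.
  rewrite uE in xE.
  refine (etrans xE _).
  refine (etrans _ (esym e)).
  exact: (congr1 (fun w : free_op E 3 => w + v)
    (scalerA c d (two a b (s leaf0) (s leaf1) (s leaf2)))).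
have Dlin := linearP D; rewrite Dlin Ds (IH y) // scaler0 addr0 //.
Qed.

End Level3.

(** * Comparison of partitions by computation *)

Section SamePartition.
Variable n : nat.
Implicit Types t u : btree unit (btree unit 'I_n).

Definition same_mem (s s' : seq 'I_n) := all (mem s') s && all (mem s) s'.
(** Inclusion of the sets of blocks, not refinement in the usual order. It is phrased on lists so
    that it evaluates on concrete partitions of {0, 1, 2, 3}. *)
Definition refines t u :=
  all (fun S => has (fun S' => same_mem (leaves S) (leaves S')) (leaves u)) (leaves t).

Lemma same_memP (S S' : btree unit 'I_n) :
  reflect (block S = block S') (same_mem (leaves S) (leaves S')).
Proof.
apply: (iffP andP) => [[/allP h /allP h']|/setP e].
  by apply/setP => x; rewrite !inE; apply/idP/idP => [/h|/h'].
split; apply/allP => x xs; have := e x; rewrite !inE.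
  by rewrite xs => /esym.
by rewrite xs.
Qed.

Lemma refinesP t u : reflect {subset parts t <= parts u} (refines t u).
Proof.
apply: (iffP allP) => h.
  move=> A; rewrite !inE => /mapP[S St ->].
  by have /hasP[S' S'u /same_memP ->] := h S St; apply: map_f.
move=> S St; have : block S \in parts u by apply: h; rewrite inE map_f.
by rewrite inE => /mapP[S' S'u e]; apply/hasP; exists S' => //; apply/same_memP.
Qed.

Lemma parts_eq t u : (parts t == parts u) = refines t u && refines u t.
Proof.
apply/eqP/andP => [e|[/refinesP h /refinesP h']].
  by split; apply/refinesP => A; rewrite e.
by apply/setP => A; apply/idP/idP => [/h|/h'].
Qed.
End SamePartition.

Lemma linear_relation3 (k : fieldType) (V W : lmodType k) (F : {linear V -> W})
    x (y0 y1 y2 : V) c0 c1 c2 : F (x - (c0 *: y0 + c1 *: y1 + c2 *: y2)) = 0 ->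
  F x = c0 *: F y0 + c1 *: F y1 + c2 *: F y2.
Proof.
have FD u v : F (u + v) = F u + F v by apply: linearD.
have FZ c u : F (c *: u) = c *: F u by apply: linearZ.
by rewrite linearB /= !FD !FZ => /eqP; rewrite subr_eq0 => /eqP.
Qed.

Lemma congr_comb3 (k : fieldType) (V : lmodType k) (c0 c1 c2 : k) (x x' y y' z z' : V) :
  x = x' -> y = y' -> z = z' ->
  c0 *: x + c1 *: y + c2 *: z = c0 *: x' + c1 *: y' + c2 *: z'.
Proof. by move=> -> -> ->. Qed.

Lemma expansion_comb (k : fieldType) (V : lmodType k) (c0 c1 c2 : k)
    (y1 y2 y3 y4 y5 y6 y7 y8 y9 z1 z2 z3 : V) :
    c0 *: (c0 *: y1 + c1 *: y2 + c2 *: y3) + c1 *: (c0 *: y4 + c1 *: y5 + c2 *: y6)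
      + c2 *: (c0 *: y7 + c1 *: y8 + c2 *: y9) = c0 *: z1 + c1 *: z2 + c2 *: z3 ->
  (c0 * c0) *: y1 + ((c0 * c1) *: y2 + ((c0 * c2) *: y3 + ((c1 * c0) *: y4 +
  ((c1 * c1) *: y5 + ((c1 * c2) *: y6 + ((c2 * c0) *: y7 + ((c2 * c1) *: y8 +
  ((c2 * c2) *: y9 + ((- c0) *: z1 + ((- c1) *: z2 + ((- c2) *: z3 + 0))))))))))) = 0.
Proof.
rewrite !scalerDr !scalerA !scaleNr addr0 !addrA => ->.
by rewrite -!addrA -!opprD !addrA subrr.
Qed.

(** * The associativity constraint in arity 4 *)

Section Forward.
Variable k : fieldType.
Variable D : {linear free3_12 (comE k) (comE k) -> free3_21 (comE k) (comE k)}.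
Local Notation E := (sig2_sum (comE k) (comE k)).
Local Notation R := (dist_rel (@comR k) (@comR k) D).
Local Notation a := (opa k).
Local Notation b := (opb k).
Local Notation "x • y" := (Node a x y) (at level 40).
Local Notation "x ∘ y" := (Node b x y) (at level 40).

Section Coefficients.
Variables c0 c1 c2 : k.
Hypothesis DE : val (D (base12 k 1%g)) = c0 *: two b a leaf0 leaf1 leaf2 +
    c1 *: two b a leaf1 leaf0 leaf2 + c2 *: two b a leaf2 leaf0 leaf1.

Lemma rewrite_rule n (K : ctx E 'I_n) S T U :
  omono R (plug K (S • (T ∘ U))) =
    c0 *: omono R (plug K (S ∘ (T • U))) + c1 *: omono R (plug K (T ∘ (S • U)))
    + c2 *: omono R (plug K (U ∘ (S • T))).
Proof.
have n3 (i j l : 'I_3) : uniq [:: i; j; l] -> is_ntree (Node b (Leaf i) (Node a (Leaf j) (Leaf l))).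
  by move=> u; have := ntree3 b a 1%g u; rewrite (perm1 i) (perm1 j) (perm1 l).
have Xi := oclass_ksub K (sub3 S T U) (dist_ideal_D D (base12 k 1%g)).
rewrite DE in Xi.
have vE : val (base12 k 1%g) = two a b leaf0 leaf1 leaf2 by rewrite /= relabel1.
rewrite vE in Xi.
pose F : {linear free_op E 3 -> operad R n} :=
  (qclass (@ideal _ _ R n) \o ksub K (sub3 S T U)).
have := linear_relation3 (F := F) Xi.
rewrite /F /= /two !ksub_mono ?ntree3r ?n3 //.
Qed.

Lemma rewrite_rule_l n (K : ctx E 'I_n) S T U :
  omono R (plug K ((T ∘ U) • S)) =
    c0 *: omono R (plug K (S ∘ (T • U))) + c1 *: omono R (plug K (T ∘ (S • U)))
    + c2 *: omono R (plug K (U ∘ (S • T))).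
Proof.
rewrite -rewrite_rule; exact: (teq_comm R (opa_comm k)).
Qed.

Definition x0 : 'I_4 := @Ordinal 4 0 isT.
Definition x1 : 'I_4 := @Ordinal 4 1 isT.
Definition x2 : 'I_4 := @Ordinal 4 2 isT.
Definition x3 : 'I_4 := @Ordinal 4 3 isT.

Local Notation L i := (@Leaf E 'I_4 i).

(** [((x0 ∘ x1) • x2) • x3 = (x0 ∘ x1) • (x2 • x3)], both sides rewritten as
    [∘] of two [•]-products.  The middle term [x0 ∘ (x2 • x1)] is first turned into
    [(x2 • x1) ∘ x0], which produces the coefficient [c1 * c1]. *)
Lemma associativity_expansion :
  c0 *: (c0 *: omono R (L x3 ∘ (L x2 • (L x0 • L x1)))
       + c1 *: omono R (L x2 ∘ (L x3 • (L x0 • L x1)))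
       + c2 *: omono R ((L x0 • L x1) ∘ (L x3 • L x2)))
  + c1 *: (c0 *: omono R (L x3 ∘ ((L x2 • L x1) • L x0))
       + c1 *: omono R ((L x2 • L x1) ∘ (L x3 • L x0))
       + c2 *: omono R (L x0 ∘ (L x3 • (L x2 • L x1))))
  + c2 *: (c0 *: omono R (L x3 ∘ (L x1 • (L x2 • L x0)))
       + c1 *: omono R (L x1 ∘ (L x3 • (L x2 • L x0)))
       + c2 *: omono R ((L x2 • L x0) ∘ (L x3 • L x1)))
  = c0 *: omono R ((L x2 • L x3) ∘ (L x0 • L x1))
  + c1 *: omono R (L x0 ∘ ((L x2 • L x3) • L x1))
  + c2 *: omono R (L x1 ∘ ((L x2 • L x3) • L x0)).
Proof.
have A1 := rewrite_rule_l Hole (L x2 • L x3) (L x0) (L x1).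
have A2 := teq_assoc (opa_assoc D) (L x0 ∘ L x1) (L x2) (L x3) Hole.
have A3 := rewrite_rule_l (CtxL a Hole (L x3)) (L x2) (L x0) (L x1).
have A4 := rewrite_rule_l Hole (L x3) (L x2) (L x0 • L x1).
have A5 := teq_comm R (opb_comm k) (L x0) (L x2 • L x1) (CtxL a Hole (L x3)).
have A6 := rewrite_rule_l Hole (L x3) (L x2 • L x1) (L x0).
have A7 := rewrite_rule_l Hole (L x3) (L x1) (L x2 • L x0).
refine (etrans _ A1); refine (etrans _ A2); refine (esym (etrans A3 _)).
exact: (congr_comb3 _ _ _ A4 (etrans A5 A6) A7).
Qed.

Definition lf (i : 'I_4) : btree unit 'I_4 := Leaf i.
Definition nd (s t : btree unit 'I_4) := Node tt s t.
Definition fr (s t : btree unit 'I_4) : btree unit (btree unit 'I_4) :=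
  Node tt (Leaf s) (Leaf t).

Definition expansion : seq (k * btree unit (btree unit 'I_4)) :=
  [:: (c0 * c0, fr (lf x3) (nd (lf x2) (nd (lf x0) (lf x1))));
      (c0 * c1, fr (lf x2) (nd (lf x3) (nd (lf x0) (lf x1))));
      (c0 * c2, fr (nd (lf x0) (lf x1)) (nd (lf x3) (lf x2)));
      (c1 * c0, fr (lf x3) (nd (nd (lf x2) (lf x1)) (lf x0)));
      (c1 * c1, fr (nd (lf x2) (lf x1)) (nd (lf x3) (lf x0)));
      (c1 * c2, fr (lf x0) (nd (lf x3) (nd (lf x2) (lf x1))));
      (c2 * c0, fr (lf x3) (nd (lf x1) (nd (lf x2) (lf x0))));
      (c2 * c1, fr (lf x1) (nd (lf x3) (nd (lf x2) (lf x0))));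
      (c2 * c2, fr (nd (lf x2) (lf x0)) (nd (lf x3) (lf x1)));
      (- c0, fr (nd (lf x2) (lf x3)) (nd (lf x0) (lf x1)));
      (- c1, fr (lf x0) (nd (nd (lf x2) (lf x3)) (lf x1)));
      (- c2, fr (lf x1) (nd (nd (lf x2) (lf x3)) (lf x0)))].

Lemma expansion_eq0 : \sum_(p <- expansion) p.1 *: omono R (flat a b p.2) = 0.
Proof.
rewrite /expansion !big_cons big_nil.
exact: (expansion_comb associativity_expansion).
Qed.

Lemma expansion_nforest p : p \in expansion -> is_nforest p.2.
Proof.
have chk t : uniq (labels t) && all (mem (labels t)) [:: x0; x1; x2; x3] -> is_nforest t.
  case/andP => u /allP h; apply: uniq_perm => //; rewrite ?enum_uniq // => x.
  rewrite mem_enum; apply: h.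
  by case: x => [[|[|[|[|]]]]].
by move: p; apply/allP; rewrite /= !chk.
Qed.

(** Injectivity of xi(4) lifts the relation from P(4) to Com o Com, where the coordinate at the
    partition of [t] collects the terms with these blocks. *)
Lemma chi_expansion (xi : {linear comp21 (@comR k) (@comR k) 4 -> operad R 4}) t :
    is_xi xi -> bijective xi ->
  \sum_(p <- expansion) p.1 * (refines p.2 t && refines t p.2)%:R = 0.
Proof.
move=> hxi xib.
have z0 : \sum_(p <- expansion) p.1 *: part_gen k (parts p.2) = 0.
  apply: (bij_inj xib); rewrite linear0 linear_sum /= -[RHS]expansion_eq0.
  rewrite big_seq [RHS]big_seq; apply: eq_bigr => p /expansion_nforest np.
  by rewrite linearZ /= (xi_part_gen hxi np).
have := congr1 (chi (parts t)) z0; rewrite linear0 linear_sum /= => e; rewrite -[RHS]e {e}.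
rewrite big_seq [RHS]big_seq; apply: eq_bigr => p /expansion_nforest np.
by rewrite linearZ /= chi_part_gen // parts_eq.
Qed.

Lemma coef_eq0 (xi : {linear comp21 (@comR k) (@comR k) 4 -> operad R 4}) :
  is_xi xi -> bijective xi -> [/\ c0 = 0, c1 = 0 & c2 = 0].
Proof.
move=> hxi xib.
have H t := @chi_expansion _ t hxi xib.
have c10 : c1 = 0.
  have := H (fr (nd (lf x2) (lf x1)) (nd (lf x3) (lf x0))).
  rewrite /expansion !big_cons big_nil /= !mulr0 !mulr1 !add0r !addr0 => /eqP.
  by rewrite mulf_eq0 orbb => /eqP.
have c20 : c2 = 0.
  have := H (fr (nd (lf x2) (lf x0)) (nd (lf x3) (lf x1))).
  rewrite /expansion !big_cons big_nil /= !mulr0 !mulr1 !add0r !addr0 => /eqP.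
  by rewrite mulf_eq0 orbb => /eqP.
(* On {0, 1}, {2, 3} the terms are c0 * c2 and -c0, the latter coming from (x0 ∘ x1) • (x2 • x3). *)
have := H (fr (nd (lf x0) (lf x1)) (nd (lf x3) (lf x2))).
rewrite /expansion !big_cons big_nil /= !mulr0 !mulr1 !add0r !addr0 c20 mulr0 add0r => /eqP.
by rewrite oppr_eq0 => /eqP.
Qed.
End Coefficients.

Lemma distributive_law_trivial : equivariant3 D ->
  distributive_law (@comR k) (@comR k) D -> forall x, D x = 0.
Proof.
move=> Deq /(_ 4 isT)[xi [hxi xib]]; apply: D_eq0 => //.
have [c0 [c1 [c2 DE]]] := span21 (in_spanP _ _ (valP (D (base12 k 1%g)))).
have [e0 e1 e2] := coef_eq0 DE hxi xib.
by apply: val_inj; rewrite DE e0 e1 e2 !scale0r !addr0 linear0.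
Qed.
End Forward.
(** * The trivial law is distributive *)

Section Partitions.
Variable n : nat.
Implicit Types t u : btree unit (btree unit 'I_n).

Lemma parts_disjoint t A B x : is_nforest t -> A \in parts t -> B \in parts t ->
  x \in A -> x \in B -> A = B.
Proof.
move=> /nforest_uniq ut; rewrite !inE => /mapP[S St ->] /mapP[S' St' ->].
rewrite !inE => xS xS'; congr block.
rewrite -(nth_index S St) -(nth_index S St'); congr nth.
apply: (uniq_flatten_nth (x := x) ut).
  by rewrite (nth_map S) ?index_mem // nth_index.
by rewrite (nth_map S) ?index_mem // nth_index.
Qed.

Lemma parts_cover t x : is_nforest t -> exists2 A, A \in parts t & x \in A.
Proof.
move=> nt; have : x \in labels t by rewrite (perm_mem nt) mem_enum.
move=> /flattenP[_ /mapP[S St ->] xS]; exists (block S); last by rewrite inE.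
by rewrite inE map_f.
Qed.

Lemma parts_nonempty t A : A \in parts t -> exists x, x \in A.
Proof.
rewrite inE => /mapP[S _ ->]; have [x [s e]] := leaves_cons S.
by exists x; rewrite inE e inE eqxx.
Qed.

(** A block of [u] meets some block of [t], which is also a block of [u] and hence the same one by
    disjointness. This upgrades the inclusion detected by [psi] to an equality. *)
Lemma parts_sub_eq t u : is_nforest t -> is_nforest u ->
  parts t \subset parts u -> parts t = parts u.
Proof.
move=> nt nu s; apply/eqP; rewrite eqEsubset s; apply/subsetP => A Au.
have [x xA] := parts_nonempty Au; have [B Bt xB] := parts_cover x nt.
by rewrite (parts_disjoint nu Au (subsetP s _ Bt) xA xB).
Qed.

End Partitions.

(** * The composition map in coordinates *)

Section Xi.
Variable k : fieldType.
Variable D : {linear free3_12 (comE k) (comE k) -> free3_21 (comE k) (comE k)}.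
Local Notation E := (sig2_sum (comE k) (comE k)).
Local Notation R := (dist_rel (@comR k) (@comR k) D).
Local Notation a := (opa k).
Local Notation b := (opb k).
Variable n : nat.
Local Notation wcls := (part_class R (n := n) a b).
Local Notation cprod := (comp21 (@comR k) (@comR k) n).

(** Prescribed on coordinates, so that the relations of the composite product need not be checked
    again; the work is moved into [xiP]. *)
Definition xi0 (z : cprod) : operad R n := \sum_p chi p z *: wcls p.

Fact xi0_linear : linear xi0.
Proof.
move=> c x y; rewrite /xi0 scaler_sumr -big_split; apply: eq_bigr => p _.
by rewrite chi_linear scalerDl scalerA.
Qed.

Definition xi := lin_of xi0_linear.

(** The scalars of the trees are pulled out by [ceps] in Com o Com and by [tscal_graft] in P, there
    in the inner trees and then in the outer one. Both sides become the same multiple of a two-level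
    product. *)
Lemma xiP : is_xi xi.
Proof.
move=> l t m u f fb nt nu.
have -> : xi (@comp_class _ _ _ _ _ n l (omono (@comR k) t) m
    (fun s => omono (@comR k) (u s)) f fb) =
    (tcoef (t : btree k 'I_l) * \prod_s tcoef (u s : btree k _)) *: wcls (label_blocks f).
  rewrite /= /xi0 -[comp_class _ _ _ _ _]/(com_class _ _ (fb : bij_label f)).
  rewrite (bigD1 (label_blocks f)) //= [X in _ + X]big1 => [|p pf]; last first.
    by rewrite chi_class eq_sym (negbTE pf) mulr0 scale0r.
  rewrite [X in X + 0]/= addr0 chi_class eqxx mulr1.
  have -> : \prod_s ceps (omono (@comR k) (u s)) = \prod_s tcoef (u s : btree k _).
    by apply: eq_bigr => s _; apply: ceps_omono.
  by rewrite (ceps_omono nt).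
have nT : perm_eq (leaves (shape t)) (enum 'I_l) by rewrite leaves_tdecor.
have nU s : perm_eq (leaves (shape (u s))) (enum 'I_(m s)).
  by rewrite leaves_tdecor; apply: nu.
rewrite -(parts_forest_of f nT nU) -omono_flat; last exact: forest_ofP.
pose F s := tlabel (f s) (tdecor (@sig2_inl k (comE k) (comE k)) (u s)).
pose G s := cmb a (@Leaf E 'I_n) (tlabel (f s) (shape (u s))).
have FG s : tscal R (tcoef (u s : btree k _)) (F s) (G s).
  have := @tscal_graft k E R n _ (fun i => Leaf (f s i)) (fun i => Leaf (f s i)) (fun=> 1)
    (@sig2_inl k (comE k) (comE k)) a (u s) (@sig2_inlE k).
  rewrite big1 ?mulr1 // => h; rewrite /F /G /tlabel.
  have -> : cmb a Leaf (graft (fun i => Leaf (f s i)) (shape (u s))) =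
    cmb a (fun i => Leaf (f s i)) (shape (u s)) by rewrite /cmb; elim: (u s) => //= e L -> r ->.
  by apply: h => i K; rewrite scale1r.
have := @tscal_graft k E R n _ F G (fun s => tcoef (u s : btree k _))
    (@sig2_inr k (comE k) (comE k)) b t (@sig2_inrE k) FG Hole.
rewrite /= (perm_big _ nt) /= big_enum /= => ->; congr (_ *: omono _ _).
rewrite /flat /forest_of /cmb.
by elim: (t) => //= e L -> r ->.
Qed.

End Xi.

(** * Algebras that separate partitions *)

Section Psi.
Variables (k : fieldType) (n : nat) (s : {set {set 'I_n}}).
Local Notation E := (sig2_sum (comE k) (comE k)).
Local Notation W := {mpoly k[n]}.
Local Notation V := (W * k^o)%type.

Definition set_mon (A : {set 'I_n}) : mpoly.multinom n := [multinom (i \in A : nat) | i < n].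

Lemma set_mon_inj : injective set_mon.
Proof.
move=> A B /mnmP e; apply/setP => i; have := e i; rewrite !mnmE.
by case: (i \in A); case: (i \in B).
Qed.

(** On square-free monomials, the indicator of those whose support belongs to [s]; every block of a
    forest evaluates to such a monomial. *)
Definition phi (w : W) : k := \sum_(A in s) mpoly.mcoeff (set_mon A) w.

Lemma phi_linear c (w w' : W) : phi (c *: w + w') = c * phi w + phi w'.
Proof.
rewrite /phi mulr_sumr -big_split; apply: eq_bigr => A _.
by rewrite mpoly.mcoeffD mpoly.mcoeffZ.
Qed.

Lemma phi0 : phi 0 = 0.
Proof. by rewrite /phi big1 // => A _; rewrite mpoly.mcoeff0. Qed.

Lemma phi_X (A : {set 'I_n}) : phi 'X_[set_mon A] = (A \in s)%:R.
Proof.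
rewrite /phi; have [As|As] := boolP (A \in s).
  rewrite (bigD1 A) //= mpoly.mcoeffX eqxx big1 ?addr0 // => B /andP[_ BA].
  by rewrite mpoly.mcoeffX (inj_eq set_mon_inj) eq_sym (negbTE BA).
rewrite big1 // => B Bs; rewrite mpoly.mcoeffX (inj_eq set_mon_inj).
by case: eqP => // e; rewrite e Bs in As.
Qed.

Lemma prod_X (S : seq 'I_n) : uniq S ->
  \prod_(i <- S) 'X_i = 'X_[set_mon [set i in S]] :> W.
Proof.
move=> uS; rewrite mpolyXE_id big_uniq // [LHS]big_mkcond; apply: eq_bigr => i _.
by rewrite mnmE inE; case: (i \in S).
Qed.

Definition aug (x : V) : k := phi x.1 + x.2.

(** On this algebra, [a] multiplies monomials and [b] multiplies the counits
    [aug] of its arguments, so that [a(x, b(y, z)) = 0]. *)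
Definition pop (e : E) (x y : V) : V :=
  ((e.1 : k) *: (x.1 * y.1), ((e.2 : k) * aug x * aug y : k^o)).

Lemma aug_linear c (x y : V) : aug (c *: x + y) = c * aug x + aug y.
Proof. by rewrite /aug /= phi_linear /GRing.scale /=; ring. Qed.

Lemma pop_e x y : linear (fun e => pop e x y).
Proof.
move=> c e e'; rewrite /pop -[RHS]/(_, _) /=; congr (_, _).
  by rewrite scalerDl scalerA.
by rewrite /GRing.scale /=; ring.
Qed.

Lemma pop_l e y : linear (fun x => pop e x y).
Proof.
move=> c x x'; rewrite /pop -[RHS]/(_, _) aug_linear /=; congr (_, _).
  by rewrite mulrDl scalerDr -scalerAl !scalerA mulrC.
by rewrite /GRing.scale /=; ring.
Qed.

Lemma pop_r e x : linear (pop e x).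
Proof.
move=> c y y'; rewrite /pop -[RHS]/(_, _) aug_linear /=; congr (_, _).
  by rewrite mulrDr scalerDr -scalerAr !scalerA mulrC.
by rewrite /GRing.scale /=; ring.
Qed.

Lemma pop_swap e x y : pop (swap e) x y = pop e y x.
Proof. by rewrite /pop /= [x.1 * _]mulrC; congr (_, _); rewrite mulrAC. Qed.

Lemma pop_assoc_a x y z : pop (opa k) (pop (opa k) x y) z = pop (opa k) x (pop (opa k) y z).
Proof. by rewrite /pop /= !scale1r !mul0r mulrA. Qed.

(** Products by [b] lie in the summand k, where [aug] is the identity, so both sides are the product
    of the three values of [aug]. *)
Lemma pop_assoc_b x y z : pop (opb k) (pop (opb k) x y) z = pop (opb k) x (pop (opb k) y z).
Proof. by rewrite /pop /aug /= !scale0r phi0 !add0r !mul1r mulrA. Qed.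

Lemma pop_ab x y z : pop (opa k) x (pop (opb k) y z) = 0.
Proof. by rewrite /pop /= scale0r mulr0 scaler0 !mul0r. Qed.

Definition gens (i : 'I_n) : V := ('X_i, 0).

Lemma teval_block (S : btree unit 'I_n) :
  teval pop gens (cmb (opa k) Leaf S) = (\prod_(i <- leaves S) 'X_i, 0).
Proof.
elim: S => [i|[] l IHl r IHr] /=; first by rewrite big_seq1.
by rewrite /cmb /= in IHl IHr *; rewrite IHl IHr /pop /= scale1r !mul0r big_cat.
Qed.

(** [aug] is multiplicative for [b], and on a block it is 1 or 0 according as the block belongs to
    [s]. *)
Lemma aug_flat t : is_nforest t ->
  aug (teval pop gens (flat (opa k) (opb k) t)) = (parts t \subset s)%:R.
Proof.
move=> nt.
have H u : aug (teval pop gens (flat (opa k) (opb k) u)) =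
    \prod_(S <- leaves u) aug (teval pop gens (cmb (opa k) Leaf S)).
  rewrite /flat {1}/cmb; elim: u => [S|[] l IHl r IHr] /=; first by rewrite big_seq1.
  by rewrite {1}/aug /= scale0r phi0 add0r mul1r IHl IHr big_cat.
rewrite H big_seq (eq_bigr (fun S => (block S \in s)%:R)); last first.
  move=> S St; rewrite teval_block /aug /= addr0 prod_X ?phi_X //.
  exact: (uniq_flatten_in (nforest_uniq nt)).
rewrite -big_seq; have -> : (parts t \subset s) = all (fun S => block S \in s) (leaves t).
  apply/subsetP/allP => [h S St|h A]; first by apply: h; rewrite inE map_f.
  by rewrite inE => /mapP[S St ->]; apply: h.
elim: (leaves t) => [|S r IH]; first by rewrite big_nil.
by rewrite big_cons IH /=; case: (block S \in s); rewrite ?mul1r ?mul0r.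
Qed.

Variable D : {linear free3_12 (comE k) (comE k) -> free3_21 (comE k) (comE k)}.
Hypothesis D0 : forall x, D x = 0.
Local Notation R := (dist_rel (@comR k) (@comR k) D).

(** For D = 0 the relation x - D(x) is x itself, a combination of relabellings of a(0, b(1, 2)),
    which vanish by [pop_ab]. *)
Lemma eval_dist y : R y -> forall v, eval pop v y = 0.
Proof.
have elin v := eval_linear pop_e pop_l pop_r pop_swap (n := 3) v.
have e0 v : eval pop v (0 : free_op E 3) = 0.
  by have := elin v (-1) 0 0; rewrite !scaleN1r !addNr.
have eD v (x y' : free_op E 3) : eval pop v (x + y') = eval pop v x + eval pop v y' :> V.
  by have := elin v 1 x y'; rewrite !scale1r.
move=> [r1 [x [r2 [R1 R2 ->]]]] v; rewrite D0 subspace_val0 subr0.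
have z1 : eval pop v (free_map (@sig2_inl k (comE k) (comE k)) r1) = 0 :> V.
  apply: (eval_free_map_comR (@sig2_inl_linear k (comE k) (comE k))
    (@sig2_inl_swap k (comE k) (comE k)) pop_e pop_l pop_r pop_swap _ v R1).
  exact: pop_assoc_a.
have z2 : eval pop v (free_map (@sig2_inr k (comE k) (comE k)) r2) = 0 :> V.
  apply: (eval_free_map_comR (@sig2_inr_linear k (comE k) (comE k))
    (@sig2_inr_swap k (comE k) (comE k)) pop_e pop_l pop_r pop_swap _ v R2).
  exact: pop_assoc_b.
have e3 u0 u1 u2 : eval pop v u0 = 0 -> eval pop v u1 = 0 -> eval pop v u2 = 0 ->
    eval pop v (u0 + u1 + u2) = 0 :> V.
  by move=> h0 h1 h2; rewrite !eD h0 h1 h2 !addr0.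
apply: e3 z1 _ z2.
have : lspan (orbits3 (two_level (@sig2_inl k (comE k) (comE k))
    (@sig2_inr k (comE k) (comE k)))) (val x).
  by apply/in_spanP; apply: valP x.
elim=> [//|c u w Su _ IH]; rewrite elin IH addr0.
have [d [p ->]] := orbits3_two (@sig2_inlE k) (@sig2_inrE k) Su.
have -> : eval pop v (d *: two (opa k) (opb k) (p leaf0) (p leaf1) (p leaf2)) = 0 :> V.
  have := elin v d (two (opa k) (opb k) (p leaf0) (p leaf1) (p leaf2)) 0.
  rewrite e0 !addr0 => ->.
  rewrite /two (eval_mono pop_e pop_l pop_r pop_swap) ?ntree3 //=.
  by rewrite pop_ab scaler0.
by rewrite scaler0.
Qed.

Definition psi (y : operad R n) : k := aug (oeval pop gens y).

Lemma psi_linear c x y : psi (c *: x + y) = c * psi x + psi y.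
Proof.
rewrite /psi (oeval_linear pop_e pop_l pop_r pop_swap eval_dist gens c x y).
exact: aug_linear.
Qed.

Lemma psi_flat t : is_nforest t ->
  psi (omono R (flat (opa k) (opb k) t)) = (parts t \subset s)%:R.
Proof.
move=> nt; rewrite /psi (oeval_omono pop_e pop_l pop_r pop_swap eval_dist) ?is_ntree_flat //.
exact: aug_flat.
Qed.
End Psi.

(** * Bijectivity of xi for D = 0 *)

Section Backward.
Variable k : fieldType.
Variable D : {linear free3_12 (comE k) (comE k) -> free3_21 (comE k) (comE k)}.
Hypothesis D0 : forall x, D x = 0.
Local Notation E := (sig2_sum (comE k) (comE k)).
Local Notation R := (dist_rel (@comR k) (@comR k) D).
Local Notation a := (opa k).
Local Notation b := (opb k).
Variable n : nat.
Hypothesis n_gt0 : (0 < n)%N.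
Local Notation wcls := (part_class R (n := n) a b).

Lemma part_gen_eq0 (p : {set {set 'I_n}}) :
  (forall t, is_nforest t -> parts t <> p) -> part_gen k p = 0 :> comp_prod _ _ n.
Proof.
move=> np; rewrite /part_gen; case: pselect => // h; exfalso.
case: h => -[l mu m nu f fb] /= [m0 fp].
(* Some label exists since n > 0, and it lies in a block. *)
have l0 : (0 < l)%N.
  case: fb => g _ _; case: (g (Ordinal n_gt0)) => i _.
  by apply: leq_ltn_trans (ltn_ord i).
have [T nT] := left_combP l0.
have /cid[U nU] : exists U : forall s, btree unit 'I_(m s),
    forall s, perm_eq (leaves (U s)) (enum 'I_(m s)).
  exists (fun s => sval (cid (left_combP (m0 s)))) => s.
  exact: (svalP (cid (left_combP (m0 s)))).
apply: (np (forest_of f T U)); first exact: forest_ofP.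
by rewrite (parts_forest_of f nT nU).
Qed.

(** For a partition [p], applying [psi p] to xi(z), written in coordinates, leaves exactly
    [chi p z]; hence these coordinates vanish on the kernel. *)
Lemma xi_inj : injective (xi D n).
Proof.
suff H z : xi D n z = 0 -> z = 0.
  move=> x y e; apply/eqP; rewrite -subr_eq0; apply/eqP/H.
  by rewrite linearB e subrr.
move=> z0; rewrite [z]part_gen_span big1 // => p _.
have [[t [nt tp]]|np] := pselect (exists t, is_nforest t /\ parts t = p); last first.
  rewrite part_gen_eq0 ?scaler0 // => t nt tp; apply: np; by exists t.
suff -> : chi p z = 0 by rewrite scale0r.
pose P0 (y : operad R n) : k^o := psi p y.
have P0lin : linear P0 := psi_linear p D0.
have psi0 : psi p (0 : operad R n) = 0 := linear0 (lin_of P0lin).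
rewrite -[RHS]psi0 -z0 /= /xi0.
have -> : psi p (\sum_q chi q z *: wcls q) = \sum_q chi q z * psi p (wcls q).
  rewrite -[LHS]/(lin_of P0lin _) linear_sum; apply: eq_bigr => q _.
  by rewrite linearZ.
have wE q : psi p (wcls q) = (q == p)%:R.
  have [[u [nu uq]]|nq] := pselect (exists t, is_nforest t /\ parts t = q).
    rewrite -uq -omono_flat // psi_flat //; congr (_%:R); rewrite -tp.
    congr nat_of_bool; apply/idP/eqP => [|->//]; exact: parts_sub_eq.
  rewrite /part_class; case: pselect => // _; rewrite psi0.
  by case: eqP => // qp; case: nq; exists t; rewrite qp.
rewrite (bigD1 p) //= wE eqxx mulr1 big1 ?addr0 // => q qp.
by rewrite wE (negbTE qp) mulr0.
Qed.

Lemma rewrite_rule0 (K : ctx E 'I_n) S T U :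
  omono R (plug K (Node a S (Node b T U))) = 0.
Proof.
have DE : val (D (base12 k 1%g)) = 0 *: two b a leaf0 leaf1 leaf2 +
    0 *: two b a leaf1 leaf0 leaf2 + 0 *: two b a leaf2 leaf0 leaf1.
  by rewrite D0 subspace_val0 !scale0r !addr0.
by rewrite (rewrite_rule DE) !scale0r !addr0.
Qed.

Definition decor_ab (B : btree bool 'I_n) : btree E 'I_n :=
  tdecor (fun c : bool => if c then a else b) B.

(** A [b]-product of two-level trees is two-level. An [a]-product is two-level when both factors are
    single blocks; otherwise a factor is a [b]-product and the tree vanishes. *)
Lemma decor_ab_flat B :
  (forall K, omono R (plug K (decor_ab B)) = 0) \/ exists t, decor_ab B = flat a b t.
Proof.
elim: B => [i|c l IHl r IHr]; first by right; exists (Leaf (Leaf i)).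
case: IHl => [l0|[tl El]]; first by left => K; apply: (l0 (CtxL _ K _)).
case: IHr => [r0|[tr Er]]; first by left => K; apply: (r0 (CtxR _ _ K)).
rewrite /decor_ab /= -/(decor_ab l) -/(decor_ab r) El Er.
case: c; last by right; exists (Node tt tl tr).
case: tl {El} => [S|[] l1 l2].
  case: tr {Er} => [S'|[] r1 r2]; first by right; exists (Leaf (Node tt S S')).
  by left => K; apply: rewrite_rule0.
left => K; rewrite -(rewrite_rule0 K (flat a b tr) (flat a b l1) (flat a b l2)).
exact: (teq_comm R (opa_comm k)).
Qed.

(** Every decoration is a combination of [a] and [b], and a tree is linear in each vertex; the other
    vertices stay in the context while one is expanded. *)
Lemma decor_ab_span (P : operad R n -> Prop) :
    (forall c x y, P x -> P y -> P (c *: x + y)) ->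
  forall (T : btree E 'I_n) K, (forall B, P (omono R (plug K (decor_ab B)))) ->
  P (omono R (plug K T)).
Proof.
move=> Plin; elim=> [i|e l IHl r IHr] K H; first exact: (H (Leaf i)).
have Hab (c : bool) : P (omono R (plug K (Node (if c then a else b) l r))).
  apply: (IHl (CtxL _ K r)) => Bl; apply: (IHr (CtxR _ (decor_ab Bl) K)) => Br.
  exact: (H (Node c Bl Br)).
have P0 : P 0.
  by have := Plin (-1) _ _ (Hab true) (Hab true); rewrite scaleN1r addNr.
have P2 c d u v : P u -> P v -> P (c *: u + d *: v).
  by move=> Pu Pv; apply: (Plin) => //; rewrite -[d *: v]addr0; apply: Plin.
have mono2 c d : mono (plug K (Node (c *: a + d *: b) l r)) =
    c *: mono (plug K (Node a l r)) + d *: mono (plug K (Node b l r)).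
  rewrite -(mono_plug_scale K d); apply: mono_lin; exact/plug_lin/lin_root.
have class2 c d (x y : free_op E n) : qclass (@ideal _ _ R n) (c *: x + d *: y) =
    c *: qclass (@ideal _ _ R n) x + d *: qclass (@ideal _ _ R n) y.
  by rewrite linearP linearZ.
have eE : e = (e.1 : k) *: a + (e.2 : k) *: b.
  case: (e) => e1 e2; rewrite -sig2_inlE -sig2_inrE /sig2_inl /sig2_inr.
  by rewrite -[RHS]/(_, _) /= addr0 add0r.
rewrite eE /omono mono2.
move: (P2 (e.1 : k) (e.2 : k) _ _ (Hab true) (Hab false)).
by rewrite /omono -class2.
Qed.

Lemma xi_surj y : exists z, xi D n z = y.
Proof.
pose P y := exists z, xi D n z = y.
have Plin c u v : P u -> P v -> P (c *: u + v).
  by move=> [x <-] [x' <-]; exists (c *: x + x'); rewrite linearP.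
have Pm T : P (omono R T).
  apply: (@decor_ab_span P Plin T Hole) => B.
  have [->|[t /= ->]] := decor_ab_flat B; first by exists 0; rewrite linear0.
  have [nt|nt] := boolP (is_nforest t).
    by exists (part_gen k (parts t)); apply: xi_part_gen => //; apply: xiP.
  exists 0; rewrite linear0 /omono mono_eq0 ?raddf0 //.
  by rewrite is_ntree_flat.
rewrite -/(P y) -[y]qreprK [qrepr y]free_linext.
rewrite (linear_linext (qclass _)) /linext.
apply: (big_ind P); first by exists 0; rewrite linear0.
- by move=> u v Pu Pv; rewrite -[u]scale1r; apply: Plin.
- move=> t _ /=; rewrite -[_ *: _]addr0; apply: Plin; first exact: Pm.
  by exists 0; rewrite linear0.
Qed.

Lemma xi_bij : bijective (xi D n).
Proof.
exists (fun y => sval (cid (xi_surj y))) => [z|y]; last by case: (cid _).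
by apply: xi_inj; case: (cid _).
Qed.
End Backward.

Theorem theorem6p1 (k : fieldType) (char0 : [pchar k] =i pred0)
    (D : {linear free3_12 (comE k) (comE k) -> free3_21 (comE k) (comE k)})
    (D_equivariant : equivariant3 D) :
  distributive_law (@comR k) (@comR k) D <-> (forall x, D x = 0).
Proof.
split; first exact: distributive_law_trivial.
move=> D0 n n2; exists (xi D n); split; first exact: xiP.
exact: xi_bij D0 _ (ltnW n2).
Qed.
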